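(* (Directional Danskin's Theorem) Let $f:\mathbb R^{n+m}\to\mathbb R$ be continuous and let $\Gamma\subseteq\mathbb R^m$ be closed. Let $\bar x,u\in\mathbb R^n$, and suppose that for a given neighborhood $U(\bar x)$ of $\bar x$ the gradient $\nabla_xf(x,y)$ exists and is continuous (jointly) for $(x,y)\in U(\bar x)\times\Gamma$. Let $V(x):=\inf_{y\in\Gamma}f(x,y)$ with solution map $S(x)=\{y\in\Gamma:f(x,y)=V(x)\}$. (i) Suppose that the restricted inf-compactness holds at $\bar x$ in direction $u$ with compact set $\Omega_u$. Then $V$ is Lipschitz around $\bar x$ in direction $u$ and $$\emptyset\ne\partial V(\bar x;u)\subseteq\bigcup_{y\in S(\bar x;u)\cap\Omega_u}\{\nabla_xf(\bar x,y)\},$$ $$\partial^cV(\bar x;u)=\mathrm{co}\{\nabla_xf(\bar x,y): y\in S(\bar x;u)\cap\Omega_u\}.$$ (ii) Suppose that there exists $\bar y\in S(\bar x)$ such that $S$ is inner semicontinuous at $(\bar x,\bar y)$ in direction $u$. Then $V$ is Lipschitz around $\bar x$ in direction $u$ and $\partial V(\bar x;u)=\{\nabla_xf(\bar x,\bar y)\}$.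
   Context: $\mathbb B$ is the open unit ball; $\mathrm{co}$ is the convex hull. For $d\in\mathbb R^n$, $\varepsilon,\delta>0$: $\mathcal V_{\varepsilon,\delta}(d)=\{z\in\varepsilon\mathbb B : \big\|\,\|d\|z-\|z\|d\,\big\|\le\delta\|z\|\|d\|\}$. $x^k\xrightarrow{u}\bar x$ means there are $t_k\downarrow0$ $(t_k>0)$, $u^k\to u$ with $x^k=\bar x+t_ku^k$. $S(\bar x;u)=\{y\in S(\bar x):\exists t_k\downarrow0,u^k\to u,y^k\to y,\ y^k\in S(\bar x+t_ku^k)\}$. $V$ is Lipschitz around $\bar x$ in direction $u$ if there are $L\ge0$, $\varepsilon,\delta>0$ such that $V$ is finite and satisfies $|V(x)-V(x')|\le L\|x-x'\|$ for all $x,x'\in\bar x+\mathcal V_{\varepsilon,\delta}(u)$. Restricted inf-compactness holds at $\bar x$ in direction $u$ with compact set $\Omega_u\subseteq\mathbb R^m$ if $V(\bar x)$ is finite and there are $\varepsilon,\delta>0$ such that $S(x)\cap\Omega_u\ne\emptyset$ for all $x\in\bar x+\mathcal V_{\varepsilon,\delta}(u)$ with $V(x)<V(\bar x)+\varepsilon$. $S$ is inner semicontinuous at $(\bar x,\bar y)$, $\bar y\in S(\bar x)$, in direction $u$ if for every $x^k\xrightarrow{u}\bar x$ there are $y^k\in S(x^k)$ ($k$ sufficiently large) with $y^k\to\bar y$. For extended-real-valued $h$ finite at $x$, $\widehat\partial h(x)=\{\xi:h(x')\ge h(x)+\langle\xi,x'-x\rangle+o(\|x'-x\|)\}$; $\partial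 h(\bar x;u)=\{\xi:\exists x^k\xrightarrow{u}\bar x,\xi^k\to\xi,\ h(x^k)\to h(\bar x),\ \xi^k\in\widehat\partial h(x^k)\}$; and for $h$ Lipschitz around $\bar x$ in direction $u$, the directional Clarke subdifferential is $\partial^ch(\bar x;u)=\mathrm{co}\,\partial h(\bar x;u)$. *)

(* Defs.v *)
From HB Require Import structures.
From mathcomp Require Import all_boot all_order all_algebra.
From mathcomp Require Import all_classical all_reals all_analysis.

Set Implicit Arguments.
Unset Strict Implicit.
Unset Printing Implicit Defensive.

Import Order.TTheory GRing.Theory Num.Theory.
Import numFieldNormedType.Exports.

Local Open Scope classical_set_scope.
Local Open Scope ring_scope.

Section Defs.
Context {R : realType}.

(* The library norm [`|x|] on row vectors is the max norm; it induces the same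
   topology, but the sets [dir_nbhd] below depend on the norm itself. *)
Definition inner n (x y : 'rV[R]_n) : R := \sum_(i < n) x 0 i * y 0 i.
Definition enorm n (x : 'rV[R]_n) : R := Num.sqrt (inner x x).

Definition gradient n (g : 'rV[R]_n -> R) (x : 'rV[R]_n) : 'rV[R]_n :=
  \row_(i < n) 'D_(delta_mx 0 i) g x.

Definition convex_hull n (A : set 'rV[R]_n) : set 'rV[R]_n :=
  smallest (fun C => convex_set C) A.

Definition dir_nbhd n (eps delta : R) (d : 'rV[R]_n) : set 'rV[R]_n :=
  [set z | enorm z < eps /\
           enorm (enorm d *: z - enorm z *: d) <= delta * enorm z * enorm d].

(* [t_k] decreases to 0 in the sense [t_k > 0] and [t_k --> 0]; monotonicity of
   the sequence is not required. *)
Definition dir_cvg n (xs : nat -> 'rV[R]_n) (xbar u : 'rV[R]_n) : Prop :=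
  exists (t : nat -> R) (us : nat -> 'rV[R]_n),
    [/\ forall k, 0 < t k, t @ \oo --> (0 : R), us @ \oo --> u &
        forall k, xs k = xbar + t k *: us k].

Definition dir_lipschitz n (V : 'rV[R]_n -> \bar R) (xbar u : 'rV[R]_n) : Prop :=
  exists L eps delta : R,
    [/\ 0 <= L, 0 < eps, 0 < delta,
        forall z, dir_nbhd eps delta u z -> V (xbar + z) \is a fin_num &
        forall z z', dir_nbhd eps delta u z -> dir_nbhd eps delta u z' ->
          `|fine (V (xbar + z)) - fine (V (xbar + z'))| <=
            L * enorm ((xbar + z) - (xbar + z'))].

(* [h x' >= h x + <xi, x' - x> + o(|x' - x|)]; the remainder [r] is real-valued,
   so the inequality rules out [h x' = -oo] near [x] but allows [+oo]. *)
Definition frechet_subdiff n (h : 'rV[R]_n -> \bar R) (x : 'rV[R]_n) :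
    set 'rV[R]_n :=
  [set xi | h x \is a fin_num /\
    exists r : 'rV[R]_n -> R^o,
      r =o_x (fun x' => enorm (x' - x) : R^o) /\
      \forall x' \near x,
        (h x + (inner xi (x' - x))%:E + (r x')%:E <= h x')%E].

Definition dir_subdiff n (h : 'rV[R]_n -> \bar R) (xbar u : 'rV[R]_n) :
    set 'rV[R]_n :=
  [set xi | h xbar \is a fin_num /\
    exists (xs : nat -> 'rV[R]_n) (xis : nat -> 'rV[R]_n),
      [/\ dir_cvg xs xbar u, xis @ \oo --> xi,
          (fun k => h (xs k)) @ \oo --> h xbar &
          forall k, frechet_subdiff h (xs k) (xis k)]].

Definition dir_clarke_subdiff n (h : 'rV[R]_n -> \bar R) (xbar u : 'rV[R]_n) :
    set 'rV[R]_n :=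
  convex_hull (dir_subdiff h xbar u).

Definition value_fun n m (f : 'rV[R]_n * 'rV[R]_m -> R) (Gamma : set 'rV[R]_m)
    (x : 'rV[R]_n) : \bar R :=
  ereal_inf [set (f (x, y))%:E | y in Gamma].

Definition sol_map n m (f : 'rV[R]_n * 'rV[R]_m -> R) (Gamma : set 'rV[R]_m)
    (x : 'rV[R]_n) : set 'rV[R]_m :=
  [set y | Gamma y /\ (f (x, y))%:E = value_fun f Gamma x].

Definition dir_sol n m (S : 'rV[R]_n -> set 'rV[R]_m) (xbar u : 'rV[R]_n) :
    set 'rV[R]_m :=
  [set y | S xbar y /\
    exists (t : nat -> R) (us : nat -> 'rV[R]_n) (ys : nat -> 'rV[R]_m),
      [/\ (forall k, 0 < t k) /\ t @ \oo --> (0 : R), us @ \oo --> u,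
          ys @ \oo --> y & forall k, S (xbar + t k *: us k) (ys k)]].

Definition restricted_inf_compact n m (V : 'rV[R]_n -> \bar R)
    (S : 'rV[R]_n -> set 'rV[R]_m) (xbar u : 'rV[R]_n)
    (Omega : set 'rV[R]_m) : Prop :=
  [/\ compact Omega, V xbar \is a fin_num &
    exists eps delta : R, [/\ 0 < eps, 0 < delta &
      forall z, dir_nbhd eps delta u z ->
        (V (xbar + z)%R < V xbar + eps%:E)%E ->
        S (xbar + z) `&` Omega !=set0]].

Definition dir_inner_semicontinuous n m (S : 'rV[R]_n -> set 'rV[R]_m)
    (xbar : 'rV[R]_n) (ybar : 'rV[R]_m) (u : 'rV[R]_n) : Prop :=
  S xbar ybar /\
  forall xs : nat -> 'rV[R]_n, dir_cvg xs xbar u ->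
    exists ys : nat -> 'rV[R]_m,
      (\forall k \near \oo, S (xs k) (ys k)) /\ ys @ \oo --> ybar.

End Defs.

(* Main.v *)
(** A Fréchet subgradient of [V] at [x] equals the gradient of [f(., y)] at [x]
    for every [y] in [S x], because [V <= f(., y)] with equality at [x].
    Restricted inf-compactness therefore makes [V] Lipschitz on a directional
    neighbourhood (mean value theorem in [f(., y)] with [y] in a compact set),
    bounds its Fréchet subgradients, and gives the inclusion by compactness.

    For the Clarke part fix [y] in [S(xbar; u)] and a vector [v].  At nearby
    points [x0 = xbar + t w] with [y'] in [S x0], the increase of [V] along [v]
    is at most that of [f(., y')].  A fuzzy mean value inequality then provides
    Fréchet subgradients of [V] near [x0] whose product with [v] is at most
    slightly more than that of the gradient of [f(., y)] at [xbar].  In the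
    limit, no linear functional separates this gradient from the compact set of
    directional subgradients, so it lies in its convex hull, which is compact
    by Carathéodory's theorem.

    Part (ii) is part (i) applied to small closed balls around [ybar]. *)

Require Import Defs.
From HB Require Import structures.
From mathcomp Require Import all_boot all_order all_algebra.
From mathcomp Require Import all_classical all_reals all_analysis.
From mathcomp Require Import ring lra.
Set Implicit Arguments.
Unset Strict Implicit.
Unset Printing Implicit Defensive.

Import Order.TTheory GRing.Theory Num.Theory.
Import numFieldNormedType.Exports.
Local Open Scope classical_set_scope.
Local Open Scope ring_scope.

(** * The Euclidean norm *)

Section Inner.
Context {R : realType} {n : nat}.
Implicit Types (x y z : 'rV[R]_n) (a : R).

Lemma innerC x y : inner x y = inner y x.
Proof. by apply: eq_bigr => i _; rewrite mulrC. Qed.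

Lemma innerDl x y z : inner (x + y) z = inner x z + inner y z.
Proof. by rewrite /inner -big_split; apply: eq_bigr => i _; rewrite mxE mulrDl. Qed.

Lemma innerZl a x y : inner (a *: x) y = a * inner x y.
Proof. by rewrite /inner mulr_sumr; apply: eq_bigr => i _; rewrite mxE mulrA. Qed.

Lemma innerDr x y z : inner x (y + z) = inner x y + inner x z.
Proof. by rewrite innerC innerDl !(innerC x). Qed.

Lemma innerZr a x y : inner x (a *: y) = a * inner x y.
Proof. by rewrite innerC innerZl innerC. Qed.

Lemma innerNl x y : inner (- x) y = - inner x y.
Proof. by rewrite -scaleN1r innerZl mulN1r. Qed.

Lemma innerNr x y : inner x (- y) = - inner x y.
Proof. by rewrite innerC innerNl innerC. Qed.

Lemma inner_ge0 x : 0 <= inner x x.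
Proof. by apply: sumr_ge0 => i _; rewrite -expr2 sqr_ge0. Qed.

Lemma inner_sqrD x y :
  inner (x + y) (x + y) = inner x x + 2 * inner x y + inner y y.
Proof. by rewrite !(innerDl, innerDr) (innerC y x); ring. Qed.

Lemma inner_delta x i : inner x (delta_mx 0 i) = x 0 i.
Proof.
rewrite /inner (bigD1 i)//= big1 ?addr0 => [|j ji]; first by rewrite mxE !eqxx mulr1.
by rewrite mxE (negbTE ji) andbF mulr0.
Qed.

Lemma le_mx_coord x i : `|x 0 i| <= `|x|.
Proof.
rewrite /Num.norm/= mx_normrE.
exact: (le_bigmax _ (fun ij : 'I_1 * 'I_n => `|x ij.1 ij.2|) (ord0, i)).
Qed.

Lemma mx_norm_le x a : 0 <= a -> (forall i, `|x 0 i| <= a) -> `|x| <= a.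
Proof.
move=> a0 xa; rewrite /Num.norm/= mx_normrE.
by apply: bigmax_le => // -[i j] _/=; rewrite ord1.
Qed.

Lemma enorm_ge0 x : 0 <= enorm x.
Proof. exact: sqrtr_ge0. Qed.

Lemma enorm_sqr x : enorm x ^+ 2 = inner x x.
Proof. by rewrite sqr_sqrtr// inner_ge0. Qed.

Lemma enormZ a x : enorm (a *: x) = `|a| * enorm x.
Proof.
by rewrite /enorm innerZl innerZr mulrA -expr2 sqrtrM ?sqr_ge0// sqrtr_sqr.
Qed.

Lemma le_enorm x : `|x| <= enorm x.
Proof.
apply: mx_norm_le => [|i]; first exact: enorm_ge0.
rewrite -(@ler_pXn2r _ 2)// ?nnegrE ?enorm_ge0// enorm_sqr real_normK ?num_real//.
rewrite /inner (bigD1 i)//= expr2 lerDl.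
by apply: sumr_ge0 => j _; rewrite -expr2 sqr_ge0.
Qed.

(** The crude factor [n.+1] stands in for the square root of [n]; it is positive even for [n = 0],
    so radii can be divided by it. *)
Lemma enorm_le x : enorm x <= n.+1%:R * `|x|.
Proof.
rewrite -(@ler_pXn2r _ 2)// ?nnegrE ?enorm_ge0 ?mulr_ge0// enorm_sqr.
have : inner x x <= \sum_(i < n) `|x| ^+ 2.
  apply: ler_sum => i _; rewrite -expr2 -[leLHS]real_normK ?num_real//.
  by rewrite lerXn2r ?nnegrE// le_mx_coord.
rewrite sumr_const card_ord => /le_trans; apply.
rewrite exprMn -[leLHS]mulr_natl; apply: ler_wpM2r; first exact: sqr_ge0.
by rewrite -natrX ler_nat expnS expn1 mulSn (leq_trans (leqnSn _))// leq_addr.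
Qed.

Lemma enorm0 : enorm (0 : 'rV[R]_n) = 0.
Proof. by apply/le_anti; rewrite enorm_ge0 (le_trans (enorm_le _))// normr0 mulr0. Qed.

Lemma enorm_eq0 x : (enorm x == 0) = (x == 0).
Proof.
apply/eqP/eqP => [x0|->]; last exact: enorm0.
by apply/eqP; rewrite -normr_eq0 eq_le normr_ge0 -x0 le_enorm.
Qed.

Lemma inner_le x y : `|inner x y| <= n%:R * (`|x| * `|y|).
Proof.
rewrite (le_trans (ler_norm_sum _ _ _))//.
have -> : n%:R * (`|x| * `|y|) = \sum_(i < n) `|x| * `|y|.
  by rewrite sumr_const card_ord -[RHS]mulr_natl.
by apply: ler_sum => i _; rewrite normrM ler_pM// le_mx_coord.
Qed.

End Inner.

Section Continuity.
Context {R : realType} {n : nat} {T : Type}.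
Implicit Types (F : set_system T) (f g : T -> 'rV[R]_n).

Lemma cvg_inner F {FF : Filter F} f g (x y : 'rV[R]_n) :
  f @ F --> x -> g @ F --> y -> (fun t => inner (f t) (g t)) @ F --> inner x y.
Proof.
move=> fx gy; rewrite /inner; apply: cvg_big => [|i _]; first exact: add_continuous.
have coord (z : 'rV[R]_n) : (fun w : 'rV[R]_n => w 0 i) @ z --> z 0 i.
  exact: coord_continuous.
by apply: cvgM; [exact: (cvg_comp _ _ fx (coord x))|exact: (cvg_comp _ _ gy (coord y))].
Qed.

Lemma cvg_enorm F {FF : Filter F} f (x : 'rV[R]_n) :
  f @ F --> x -> (fun t => enorm (f t)) @ F --> enorm x.
Proof.
move=> fx; exact: (cvg_comp _ _ (cvg_inner fx fx) (@sqrt_continuous R _)).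
Qed.

End Continuity.

(** * Directional neighbourhoods *)

Lemma cvg_dir_gap {R : realType} {n : nat} {T : Type} (F : set_system T)
    {FF : Filter F} (f : T -> 'rV[R]_n) (x u : 'rV[R]_n) (delta : R) :
  f @ F --> x ->
  enorm (enorm u *: f t - enorm (f t) *: u) - delta * enorm (f t) * enorm u
    @[t --> F] --> enorm (enorm u *: x - enorm x *: u) - delta * enorm x * enorm u.
Proof.
move=> fx.
have nf : enorm (f t) @[t --> F] --> enorm x by exact: cvg_enorm.
apply: cvgB.
  apply: (@cvg_enorm _ _ _ F _ (fun t => enorm u *: f t - enorm (f t) *: u)).
  by apply: cvgB; apply: cvgZ => //; exact: cvg_cst.
by apply: cvgM; [apply: cvgM => //|]; exact: cvg_cst.
Qed.

Section DirBall.
Context {R : realType} {n : nat}.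
Implicit Types (u z w x : 'rV[R]_n) (e t eps delta : R).

(* [dir_ball e u], [e > 0], are the sets that the sequences of [dir_cvg] enter;
   unlike [dir_nbhd] they are open, and for [u != 0] and small [e] they omit [0]. *)
Definition dir_ball e u : set 'rV[R]_n :=
  [set z | exists t w, [/\ 0 < t, t < e, `|w - u| < e & z = t *: w]].

Lemma dir_ballS e e' u : e <= e' -> dir_ball e u `<=` dir_ball e' u.
Proof.
by move=> ee' z [t [w [t0 te we ->]]]; exists t, w; split => //; exact: lt_le_trans ee'.
Qed.

Lemma dir_ball_center e u : 0 < e -> exists z, dir_ball e u z.
Proof.
move=> e0; exists ((e / 2) *: u), (e / 2), u; split => //; first lra; first lra.
by rewrite subrr normr0.
Qed.

Lemma dir_ball_norm e u z : dir_ball e u z -> `|z| <= e * (`|u| + e).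
Proof.
move=> [t [w [t0 te we ->]]]; rewrite normrZ gtr0_norm//.
have : `|w| <= `|u| + e.
  rewrite -[w](subrK u) addrC (le_trans (ler_normD _ _))// lerD2l ltW//.
by move=> wu; rewrite ler_pM// ltW.
Qed.

Lemma dir_ball_small u e : 0 < e ->
  exists2 e', 0 < e' & forall z, dir_ball e' u z -> `|z| < e.
Proof.
move=> e0; have u0 : 0 <= `|u| by [].
have h : 0 < e / (`|u| + 2) by apply: divr_gt0 => //; lra.
exists (Num.min 1 (e / (`|u| + 2))); first by rewrite lt_min ltr01 h.
set e' := Num.min _ _ => z /dir_ball_norm /le_lt_trans; apply.
have e'1 : e' <= 1 by rewrite /e' ge_min lexx.
have e'0 : 0 < e' by rewrite lt_min ltr01 h.
have : e' * (`|u| + 2) <= e by rewrite -ler_pdivlMr ?ge_min ?lexx ?orbT//; lra.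
nra.
Qed.

(** The cone inequality is positively homogeneous, so for [z = t *: w] it need only hold at [w]. At
    a nonzero [w = u] it is strict, hence it persists for [w] close to [u]; for [u = 0] both sides
    vanish. *)
Lemma dir_ball_sub_nbhd eps delta u : 0 < eps -> 0 < delta ->
  exists2 e, 0 < e & dir_ball e u `<=` dir_nbhd eps delta u.
Proof.
move=> eps0 delta0.
have N0 : 0 < n.+1%:R :> R by [].
have [e1 e10 he1] := dir_ball_small u (divr_gt0 eps0 N0).
pose psi w := enorm (enorm u *: w - enorm w *: u) - delta * enorm w * enorm u.
have [e2 e20 he2] : exists2 e2, 0 < e2 & forall w, `|w - u| < e2 -> psi w <= 0.
  have [u0|u0] := eqVneq u 0.
    exists 1 => // w _.
    by rewrite /psi u0 enorm0 scale0r scaler0 subr0 enorm0 mulr0 subr0.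
  have cpsi : psi @ u --> psi u.
    by rewrite /psi; exact: (@cvg_dir_gap _ _ _ _ _ id u u delta (@cvg_id _ (nbhs u))).
  have psiu : psi u < 0.
    rewrite /psi subrr enorm0 sub0r oppr_lt0 !mulr_gt0//;
      by rewrite lt_neqAle enorm_ge0 eq_sym enorm_eq0 u0.
  have /nbhs_ballP[e2 /= e20 h] : \forall w \near u, psi w < 0 by exact: (cvgr_lt (psi u) cpsi).
  exists e2 => // w wu; apply/ltW/h; rewrite -ball_normE/=.
  by rewrite distrC.
exists (Num.min e1 e2); first by rewrite lt_min e10.
move=> z zD; split.
  rewrite (le_lt_trans (enorm_le _))// mulrC -ltr_pdivlMr// he1//.
  by apply: dir_ballS zD; rewrite ge_min lexx.
have [t [w [t0 te we ->]]] := zD.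
have := he2 w (lt_le_trans we _); rewrite ge_min lexx orbT /psi subr_le0 => /(_ isT) h.
rewrite !enormZ gtr0_norm// scalerA [enorm u * t]mulrC -!scalerA -scalerBr enormZ gtr0_norm//.
rewrite (_ : delta * _ * _ = t * (delta * enorm w * enorm u)); last by ring.
by rewrite ler_wpM2l// ltW.
Qed.

(** For nonzero [u], write [z = t *: w] with [t = enorm z / enorm u]; then [w - u] is the vector
    inside the cone inequality divided by [enorm z], so its norm is at most [delta * enorm u], which
    is [e / 2]. The point [0] is set apart because it may lie outside [dir_ball e u]. *)
Lemma nbhd_sub_dir_ball e u : 0 < e ->
  exists eps delta, [/\ 0 < eps, 0 < delta &
    forall z, dir_nbhd eps delta u z -> z != 0 -> dir_ball e u z].
Proof.
move=> e0; have [->|u0] := eqVneq u 0.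
  (* For [u = 0] the cone inequality is void, and dividing [z] by the fixed [t = e / 2] leaves a
     norm below [e]. *)
  exists (e / 2 * e), 1; split => //; first by rewrite mulr_gt0//; lra.
  move=> z [ze _] _; exists (e / 2), ((e / 2)^-1 *: z); split; [lra|lra| |].
    rewrite subr0 normrZ gtr0_norm ?invr_gt0; last lra.
    rewrite mulrC ltr_pdivrMr; last lra.
    by rewrite mulrC (le_lt_trans (le_enorm z)).
  by rewrite scalerA divff ?scale1r//; lra.
have nu : 0 < enorm u by rewrite lt_neqAle enorm_ge0 eq_sym enorm_eq0 u0.
exists (e * enorm u), (e / enorm u / 2); split; [exact: mulr_gt0| |].
  by rewrite !divr_gt0.
move=> z [ze zd] z0.
have nz : 0 < enorm z by rewrite lt_neqAle enorm_ge0 eq_sym enorm_eq0 z0.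
exists (enorm z / enorm u), ((enorm u / enorm z) *: z); split.
- exact: divr_gt0.
- by rewrite ltr_pdivrMr.
- have -> : (enorm u / enorm z) *: z - u =
      (enorm z)^-1 *: (enorm u *: z - enorm z *: u).
    by rewrite scalerBr !scalerA mulVf ?gt_eqF// scale1r mulrC.
  rewrite (le_lt_trans (le_enorm _))// enormZ gtr0_norm ?invr_gt0//.
  rewrite mulrC ltr_pdivrMr// (le_lt_trans zd)//.
  rewrite (_ : _ * _ * _ = e / 2 * enorm z); last by field; rewrite gt_eqF.
  by rewrite ltr_pM2r//; lra.
by rewrite scalerA mulrA divfK ?gt_eqF// divff ?gt_eqF// scale1r.
Qed.

Lemma dir_ball_open e u z : dir_ball e u z ->
  exists2 r, 0 < r & forall z', `|z' - z| < r -> dir_ball e u z'.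
Proof.
move=> [t [w [t0 te we ->]]].
exists (t * (e - `|w - u|)); first by rewrite mulr_gt0// subr_gt0.
move=> z' hz'; exists t, (t^-1 *: z'); split => //; last first.
  by rewrite scalerA mulfV ?gt_eqF// scale1r.
rewrite -[t^-1 *: z'](subrK w) -addrA (le_lt_trans (ler_normD _ _))// -ltrBrDr.
rewrite -[w in X in X < _](scale1r) -[1](@mulVf _ t) ?gt_eqF// -scalerA -scalerBr.
by rewrite normrZ gtr0_norm ?invr_gt0// mulrC ltr_pdivrMr// mulrC.
Qed.

End DirBall.

(** * Sequential and epsilon forms of directional limits *)

Lemma natSinv_lt {R : realType} (e : R) : 0 < e ->
  \forall k \near \oo, k.+1%:R^-1 < e.
Proof. by move=> e0; exact: (near_infty_natSinv_lt (PosNum e0)). Qed.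

Lemma cvg_natSinv {R : realType} {V : normedModType R} (xs : nat -> V) (x : V) :
  (forall k, `|xs k - x| < k.+1%:R^-1) -> xs @ \oo --> x.
Proof.
move=> h; apply/cvgrPdist_lt => e e0; near=> k.
rewrite distrC (lt_trans (h k))//; near: k; exact: natSinv_lt.
Unshelve. all: by end_near. Qed.

Section DirSequences.
Context {R : realType} {n : nat}.
Implicit Types (u z w xbar : 'rV[R]_n) (xs : nat -> 'rV[R]_n).

Lemma dir_cvg_near xs xbar u e : dir_cvg xs xbar u -> 0 < e ->
  \forall k \near \oo, dir_ball e u (xs k - xbar).
Proof.
move=> [t [us [t0 tc uc xsE]]] e0; near=> k.
exists (t k), (us k); split => //.
- by near: k; apply: (cvgr_lt 0).
- by rewrite distrC; near: k; move/cvgrPdist_lt: uc; exact.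
- by rewrite xsE addrAC subrr add0r.
Unshelve. all: by end_near. Qed.

Lemma dir_ball_seq (zs : nat -> 'rV[R]_n) u :
  (forall k, dir_ball k.+1%:R^-1 u (zs k)) ->
  exists (t : nat -> R) (us : nat -> 'rV[R]_n),
    [/\ forall k, 0 < t k, t @ \oo --> (0 : R), us @ \oo --> u &
        forall k, zs k = t k *: us k].
Proof.
move=> zsD.
have /choice[tw htw] : forall k, exists tw : R * 'rV[R]_n,
    [/\ 0 < tw.1, tw.1 < k.+1%:R^-1, `|tw.2 - u| < k.+1%:R^-1 & zs k = tw.1 *: tw.2].
  by move=> k; have [t [w h]] := zsD k; exists (t, w).
exists (fst \o tw), (snd \o tw); split => /=.
- by move=> k; case: (htw k).
- by apply: cvg_natSinv => k; have [h1 h2 _ _] := htw k; rewrite subr0 gtr0_norm.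
- by apply: cvg_natSinv => k; have [_ _ h _] := htw k.
- by move=> k; case: (htw k).
Qed.

Lemma dir_ball_cvg xs xbar u :
  (forall k, dir_ball k.+1%:R^-1 u (xs k - xbar)) -> dir_cvg xs xbar u.
Proof.
move=> /dir_ball_seq[t [us [t0 tc uc xsE]]]; exists t, us; split => // k.
by rewrite -xsE addrC subrK.
Qed.

(** One radius [e] controls [t], the direction and the solution at once; sequences are recovered by
    choosing points for the radii [k.+1%:R^-1]. The epsilon form suits compactness arguments with
    filters. *)
Lemma dir_solP m (S : 'rV[R]_n -> set 'rV[R]_m) xbar u y :
  dir_sol S xbar u y <-> S xbar y /\ forall e, 0 < e -> exists z y',
    [/\ dir_ball e u z, S (xbar + z) y' & `|y' - y| < e].
Proof.
split => [[Sy [t [us [ys [[t0 tc] uc yc Sys]]]]]|[Sy h]]; split => //.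
  move=> e e0.
  have [k [kt ku ky]] : exists k, [/\ t k < e, `|us k - u| < e & `|ys k - y| < e].
    apply: (@filter_ex _ \oo); near=> k; split.
    - by near: k; apply: (cvgr_lt 0).
    - by rewrite distrC; near: k; move/cvgrPdist_lt: uc; exact.
    - by rewrite distrC; near: k; move/cvgrPdist_lt: yc; exact.
  by exists (t k *: us k), (ys k); split => //; exists (t k), (us k).
have /choice[zy hzy] : forall k, exists zy : 'rV[R]_n * 'rV[R]_m,
    [/\ dir_ball k.+1%:R^-1 u zy.1, S (xbar + zy.1) zy.2 & `|zy.2 - y| < k.+1%:R^-1].
  move=> k; have [|z [y' zy]] := h k.+1%:R^-1; first by rewrite invr_gt0.
  by exists (z, y').
have [|t [us [t0 tc uc zE]]] := @dir_ball_seq (fst \o zy) u.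
  by move=> k /=; case: (hzy k).
exists t, us, (snd \o zy); split => //.
  by apply: cvg_natSinv => k; case: (hzy k).
by move=> k; rewrite -zE; case: (hzy k).
Unshelve. all: by end_near. Qed.

Lemma dir_subdiffP (h : 'rV[R]_n -> \bar R) xbar u xi : h xbar \is a fin_num ->
  dir_subdiff h xbar u xi <-> forall e, 0 < e -> exists z xi',
    [/\ dir_ball e u z, frechet_subdiff h (xbar + z) xi', `|xi' - xi| < e &
        `|fine (h (xbar + z)) - fine (h xbar)| < e].
Proof.
move=> hfin; split => [[_ [xs [xis [xc xic hc hxi]]]] e e0|H].
  move: hc; rewrite -(fineK hfin) => /fine_cvgP[_ hc].
  have [k [kx kxi kh]] : exists k, [/\ dir_ball e u (xs k - xbar), `|xis k - xi| < e &
      `|fine (h (xs k)) - fine (h xbar)| < e].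
    apply: (@filter_ex _ \oo); near=> k; split.
    - by near: k; exact: dir_cvg_near.
    - by rewrite distrC; near: k; move/cvgrPdist_lt: xic; exact.
    - by rewrite distrC; near: k; move/cvgrPdist_lt: hc; exact.
  by exists (xs k - xbar), (xis k); rewrite [xbar + _]addrC subrK; split.
split => //.
have /choice[zx hzx] : forall k, exists zx : 'rV[R]_n * 'rV[R]_n,
    [/\ dir_ball k.+1%:R^-1 u zx.1, frechet_subdiff h (xbar + zx.1) zx.2,
        `|zx.2 - xi| < k.+1%:R^-1 &
        `|fine (h (xbar + zx.1)) - fine (h xbar)| < k.+1%:R^-1].
  move=> k; have [|z [y' zy]] := H k.+1%:R^-1; first by rewrite invr_gt0.
  by exists (z, y').
exists (fun k => xbar + (zx k).1), (fun k => (zx k).2); split.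
- by apply: dir_ball_cvg => k; rewrite addrAC subrr add0r; case: (hzx k).
- by apply: cvg_natSinv => k; case: (hzx k).
- rewrite -(fineK hfin); apply/fine_cvgP; split.
    (* Fréchet subgradients exist only where [h] is finite, so the values along the sequence are
       real. *)
    by apply: nearW => k; case: (hzx k) => _ [].
  by apply: cvg_natSinv => k; case: (hzx k).
- by move=> k; case: (hzx k).
Unshelve. all: by end_near. Qed.

End DirSequences.

(** * Gradients and Fréchet subgradients *)

Section Gradient.
Context {R : realType} {n : nat}.
Implicit Types (x v xi : 'rV[R]_n) (g : 'rV[R]_n -> R).

Lemma derive_gradient g x v : differentiable g x ->
  'D_v g x = inner (gradient g x) v.
Proof.
move=> gx; rewrite deriveE// {1}(row_sum_delta v) linear_sum/= /inner.
by apply: eq_bigr => i _; rewrite linearZ/= mxE deriveE// mulrC.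
Qed.

Lemma is_derive_line g x v (s : R) : differentiable g (x + s *: v) ->
  is_derive s 1 (fun s => g (x + s *: v)) (inner (gradient g (x + s *: v)) v).
Proof.
move=> gx.
have E : (fun h : R => h^-1 *: (g (x + (h *: 1 + s) *: v) - g (x + s *: v))) =
         (fun h : R => h^-1 *: (g (h *: v + (x + s *: v)) - g (x + s *: v))).
  apply/funext => h; congr (_ *: (g _ - _)).
  by rewrite [h *: 1]mulr1 scalerDl addrCA.
split; first by have := @diff_derivable _ _ _ g _ v gx; rewrite /derivable/= E.
by rewrite -derive_gradient// /derive/= E.
Qed.

Lemma mean_value_line g x v :
  (forall s, 0 <= s <= 1 -> differentiable g (x + s *: v)) ->
  exists2 s, 0 <= s <= 1 & g (x + v) - g x = inner (gradient g (x + s *: v)) v.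
Proof.
move=> gd.
have [||s /[!in_itv]/= s01] := @MVT_segment R (fun s => g (x + s *: v))
    (fun s => inner (gradient g (x + s *: v)) v) 0 1 ler01.
- move=> s /[!in_itv]/= /andP[s0 s1]; apply/is_derive_line/gd.
  by rewrite !ltW.
- apply: derivable_within_continuous => s; rewrite in_itv/= => s01.
  by have [] := is_derive_line (gd _ s01).
by rewrite scale1r scale0r addr0 subr0 mulr1 => ?; exists s.
Qed.

Lemma lipschitz_ball g x (r M : R) :
  (forall x', `|x' - x| < r -> differentiable g x' /\ `|gradient g x'| <= M) ->
  forall x1 x2, `|x1 - x| < r -> `|x2 - x| < r ->
    `|g x1 - g x2| <= n%:R * M * `|x1 - x2|.
Proof.
move=> gd x1 x2 hx1 hx2.
have seg s : 0 <= s <= 1 -> `|x2 + s *: (x1 - x2) - x| < r.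
  move=> /andP[s0 s1].
  have -> : x2 + s *: (x1 - x2) - x = s *: (x1 - x) + (1 - s) *: (x2 - x).
    by apply/rowP => i; rewrite !mxE; ring.
  rewrite (le_lt_trans (ler_normD _ _))// !normrZ !ger0_norm ?subr_ge0//.
  (* Strictness comes from the term with factor [s], so [s = 0] is treated apart. *)
  move: s0; rewrite le_eqVlt => /predU1P[<-|s0]; first by rewrite mul0r add0r subr0 mul1r.
  have h1 : s * `|x1 - x| < s * r by rewrite ltr_pM2l.
  have h2 : (1 - s) * `|x2 - x| <= (1 - s) * r by rewrite ler_wpM2l ?subr_ge0// ltW.
  by rewrite (lt_le_trans (ltr_leD h1 h2))// -mulrDl subrKC mul1r.
have [s /seg/gd[] //|s s01] := @mean_value_line g x2 (x1 - x2).
rewrite subrKC => ->; have [_ hM] := gd _ (seg _ s01).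
by rewrite (le_trans (inner_le _ _))// -mulrA ler_wpM2l// ler_wpM2r.
Qed.

Lemma cvg_line x v : (fun t : R => t *: v + x) @ 0^'+ --> x.
Proof.
rewrite -{2}[x]add0r -[0 in X in _ --> X](scale0r v); apply: cvgD; last exact: cvg_cst.
apply: cvgZ; last exact: cvg_cst.
exact: (cvg_at_right_filter (@cvg_id _ (nbhs (0 : R)))).
Qed.

Lemma cvg_derive_right g x v : differentiable g x ->
  (fun t => t^-1 * (g (t *: v + x) - g x)) @ 0^'+ --> inner (gradient g x) v.
Proof.
move=> gx; rewrite -derive_gradient//.
have := @diff_derivable _ _ _ g _ v gx; rewrite /derivable/= => gd.
apply: cvg_trans gd; apply: cvg_app; apply: within_subset.
by move=> t /= t0; rewrite gt_eqF.
Qed.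

(** Since [h <= g] near [x] with equality at [x], the subgradient inequality along the ray
    [t *: v + x] bounds [inner xi v] by the derivative of [g] along [v]; using [- v] as well gives
    equality. *)
Lemma frechet_gradient (h : 'rV[R]_n -> \bar R) g x xi :
  frechet_subdiff h x xi -> differentiable g x -> h x = (g x)%:E ->
  (\forall x' \near x, (h x' <= (g x')%:E)%E) -> xi = gradient g x.
Proof.
move=> [_ [r [ro hr]]] gx hgx hg.
suff D v : inner xi v <= inner (gradient g x) v.
  apply/rowP => i; rewrite -!inner_delta; apply/le_anti; rewrite D/=.
  by rewrite -lerN2 -!innerNr D.
rewrite leNgt; apply/negP => lt.
pose e := inner xi v - inner (gradient g x) v.
have e0 : 0 < e by rewrite subr_gt0.
(* Chosen so that on the ray the remainder is at most [t * (e / 2)]; the [1] avoids division by zero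
   when [v = 0]. *)
pose K := enorm v + 1.
have K0 : 0 < K by rewrite ltr_wpDl// enorm_ge0.
have /eqoP/(_ (e / 2 / K)) := ro.
have eK : 0 < e / 2 / K by rewrite !divr_gt0.
move=> /(_ eK) hre.
have near1 : \forall t \near 0^'+, t^-1 * (g (t *: v + x) - g x) < inner (gradient g x) v + e / 2.
  by apply: (cvgr_lt _ (cvg_derive_right gx)); rewrite ltrDl divr_gt0.
have near2 : \forall t \near 0^'+, inner xi v - e / 2 <=
    t^-1 * (g (t *: v + x) - g x).
  near=> t.
  have t0 : 0 < t by near: t; exact: nbhs_right_gt.
  have hxt : (h (t *: v + x)%R <= (g (t *: v + x)%R)%:E)%E.
    by near: t; exact: (@cvg_line x v _ hg).
  have rxt : `|r (t *: v + x)| <= e / 2 / K * `|enorm (t *: v + x - x)|.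
    by near: t; exact: (@cvg_line x v _ hre).
  have hrt : (h x + (inner xi (t *: v + x - x)%R)%:E + (r (t *: v + x)%R)%:E <=
      h (t *: v + x)%R)%E.
    by near: t; exact: (@cvg_line x v _ hr).
  have := le_trans hrt hxt; rewrite hgx -!EFinD lee_fin.
  move: rxt; rewrite addrK enormZ innerZr normrM normr_id.
  rewrite (gtr0_norm t0) (ger0_norm (enorm_ge0 v)) => rxt.
  have rK : `|r (t *: v + x)| <= t * (e / 2).
    rewrite (le_trans rxt)// mulrCA ler_pM2l// mulrAC ler_pdivrMr//.
    by rewrite ler_pM2l ?divr_gt0// lerDl.
  move=> H; rewrite -(ler_pM2l t0) mulrA divff ?gt_eqF// mul1r mulrBr.
  by move: rK; rewrite ler_norml => /andP[]; lra.
have [t] := filter_ex (filterI near1 near2).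
by move=> [/= h1 h2]; have := le_lt_trans h2 h1; rewrite /e; lra.
Unshelve. all: by end_near. Qed.

End Gradient.

(** * A fuzzy mean value inequality *)

Lemma near_dist {R : realType} {V : normedModType R} (x : V) (e : R) :
  0 < e -> \forall x' \near x, `|x' - x| < e.
Proof.
move=> e0; apply/nbhs_ballP; exists e => // x'.
by rewrite -ball_normE/= distrC.
Qed.

Section FuzzyMeanValue.
Context {R : realType} {n : nat}.
Implicit Types (x v xi : 'rV[R]_n).

Lemma compact_norm_ball x (r : R) : 0 < r -> compact [set y | `|y - x| <= r].
Proof.
move=> r0; have -> : [set y | `|y - x| <= r] = closed_ball x r.
  by rewrite closed_ballE//; apply/seteqP; split => y /=; rewrite distrC.
apply: bounded_closed_compact; last exact: closed_ball_closed.
rewrite closed_ballE//; exists (r + `|x|); split; first exact: num_real.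
move=> M rM y /= yr; rewrite -[y](subrK x) (le_trans (ler_normD _ _))//.
by rewrite (le_trans _ (ltW rM))// lerD2r distrC.
Qed.

(** This is the passage from proximal to Fréchet subgradients: the quadratic term is itself an
    admissible remainder. *)
Lemma quadratic_frechet (h : 'rV[R]_n -> \bar R) x xi (a rho : R) :
  0 < rho -> 0 <= a ->
  (forall x', `|x' - x| < rho -> h x' \is a fin_num /\
    fine (h x) + inner xi (x' - x) - a * inner (x' - x) (x' - x) <= fine (h x')) ->
  frechet_subdiff h x xi.
Proof.
move=> rho0 a0 H.
have [hx _] : h x \is a fin_num /\ _ := H x ltac:(by rewrite subrr normr0).
split => //; exists (fun x' => - (a * inner (x' - x) (x' - x))); split.
  apply/eqoP => e e0; near=> x'.
  rewrite normrN -enorm_sqr !ger0_norm ?mulr_ge0 ?enorm_ge0 ?sqr_ge0//.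
  rewrite expr2 mulrA ler_wpM2r ?enorm_ge0//.
  rewrite (le_trans (ler_wpM2l a0 (enorm_le _)))// mulrA.
  have : `|x' - x| < e / (a * n.+1%:R + 1).
    near: x'; apply: (@near_dist R 'rV[R]_n x).
    by rewrite divr_gt0// ltr_wpDl// mulr_ge0.
  rewrite ltr_pdivlMr; last by rewrite ltr_wpDl// mulr_ge0.
  rewrite mulrC => /ltW; apply: le_trans.
  by rewrite ler_wpM2r// lerDl.
near=> x'.
have /H[hx' ineq] : `|x' - x| < rho.
  near: x'; exact: (@near_dist R 'rV[R]_n x).
by rewrite -(fineK hx) -(fineK hx') -!EFinD lee_fin.
Unshelve. all: by end_near. Qed.

(* Minimise [W x + a |x - x0 - s v|^2 - s c] over [x] in a closed ball and [s]
   in [[0, s1]]: stationarity in [x] gives the subgradient [xi], stationarity in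
   [s] gives [inner xi v <= c].  For [a] large the minimiser has [x] interior
   and, because of the strict decrease along [v], [s > 0]. *)
Lemma fuzzy_mean_value (W : 'rV[R]_n -> R) x0 v (r L c s1 : R) :
  0 < r -> 0 <= L ->
  (forall x x', `|x - x0| < r -> `|x' - x0| < r ->
    `|W x - W x'| <= L * `|x - x'|) ->
  0 < s1 -> s1 * `|v| <= r / 2 -> W (x0 + s1 *: v) < W x0 + s1 * c ->
  exists x xi a rho, [/\ `|x - x0| < r, inner xi v <= c, 0 <= a, 0 < rho &
    forall x', `|x' - x| < rho ->
      W x + inner xi (x' - x) - a * inner (x' - x) (x' - x) <= W x'].
Proof.
move=> r0 L0 WL s10 s1v Ws1.
pose gam := W x0 + s1 * c - W (x0 + s1 *: v).
have gam0 : 0 < gam by rewrite subr_gt0.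
(* Both summands bound the distance [e] from the minimiser to [x0 + s *: v]: the first gives
   [e <= r / 8], the second [L * e < gam]. *)
pose a := 8 * (L + 1) / r + (L + 1) ^+ 2 / gam.
have a0 : 0 < a.
  by rewrite addr_gt0// divr_gt0// ?mulr_gt0 ?exprn_gt0//; lra.
pose Phi (p : 'rV[R]_n * R) :=
  W p.1 + a * inner (p.1 - x0 - p.2 *: v) (p.1 - x0 - p.2 *: v) - p.2 * c.
(* Points of the segment are within [r / 2] of [x0] and the minimiser within [5 / 8 * r], so the
   ball of radius [r / 8] around the minimiser stays in [A]. *)
pose A := [set y : 'rV[R]_n | `|y - x0| <= 3 / 4 * r].
pose I := [set` `[0, s1]] : set R.
have [[x s]] : exists2 p, p \in A `*` I & forall q, q \in A `*` I -> Phi p <= Phi q.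
  apply: compact_EVT_min.
  - exists (x0, 0); split => /=; first by rewrite /A/= subrr normr0; lra.
    by rewrite /I/= in_itv/= lexx ltW.
  - by apply: compact_setX; [apply: compact_norm_ball; lra|exact: segment_compact].
  - apply: continuous_in_subspaceT => -[y t] /set_mem[/= Ay It].
    have p1 : fst q @[q --> (y, t)] --> y by exact: cvg_fst.
    have p2 : snd q @[q --> (y, t)] --> t by exact: cvg_snd.
    have cW : W q.1 @[q --> (y, t)] --> W y.
      apply/cvgrPdist_lt => e e0; near=> q.
      have qy : `|y - q.1| < e / (L + 1).
        by near: q; move/cvgrPdist_lt: p1; apply; rewrite divr_gt0//; lra.
      have qr : `|y - q.1| < r / 4.
        by near: q; move/cvgrPdist_lt: p1; apply; lra.
      have yr : `|y - x0| < r by move: Ay; rewrite /A/=; lra.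
      rewrite (le_lt_trans (WL _ _ yr _))//.
        rewrite -[q.1](subrK y) -addrA (le_lt_trans (ler_normD _ _))// distrC.
        by move: Ay; rewrite /A/=; lra.
      move: qy; rewrite ltr_pdivlMr; last lra.
      apply: le_lt_trans; rewrite mulrC ler_wpM2l//; lra.
    have cd : q.1 - x0 - q.2 *: v @[q --> (y, t)] --> y - x0 - t *: v.
      apply: cvgB; first by apply: cvgB => //; exact: cvg_cst.
      by apply: cvgZ => //; exact: cvg_cst.
    apply: cvgB; last by apply: cvgM => //; exact: cvg_cst.
    apply: cvgD => //; apply: cvgM; first exact: cvg_cst.
    exact: (cvg_inner cd cd).
move=> /set_mem[/= Ax]; rewrite /I/= in_itv/= => /andP[s0 ss1] Pmin.
have {}Pmin y t : `|y - x0| <= 3 / 4 * r -> 0 <= t <= s1 -> Phi (x, s) <= Phi (y, t).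
  by move=> Ay It; apply: Pmin; apply/mem_set; split => //=; rewrite /I/= in_itv.
pose d := x - x0 - s *: v.
pose e := enorm d.
have line t : 0 <= t <= s1 -> `|(x0 + t *: v) - x0| <= r / 2.
  move=> /andP[t0 ts1]; rewrite addrAC subrr add0r normrZ ger0_norm//.
  by rewrite (le_trans _ s1v)// ler_wpM2r.
have lineA t : 0 <= t <= s1 -> `|(x0 + t *: v) - x0| <= 3 / 4 * r.
  by move=> /line; lra.
have e0 : 0 <= e by exact: enorm_ge0.
(* Comparison with [(x0 + s *: v, s)], where the penalty vanishes, gives [a * e ^+ 2 <= L * e]. *)
have ae : a * e <= L.
  have := Pmin _ s (lineA s _); rewrite s0 ss1 => /(_ isT isT).
  rewrite /Phi/= -/d -enorm_sqr -/e.
  rewrite (_ : x0 + s *: v - x0 - s *: v = 0); last by rewrite addrAC addrK subrr.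
  rewrite -enorm_sqr enorm0 expr0n/= mulr0 addr0 => H1.
  have xr : `|x - x0| < r by move: Ax; rewrite /A/=; lra.
  have lr : `|x0 + s *: v - x0| < r by have := line s; rewrite s0 ss1 => /(_ isT); lra.
  have := WL _ _ lr xr.
  have -> : x0 + s *: v - x = - d.
    by rewrite /d; apply/rowP => i; rewrite !mxE; ring.
  rewrite normrN => H2.
  have H3 : W (x0 + s *: v) - W x <= L * e.
    rewrite (le_trans (ler_norm _))// (le_trans H2)// ler_wpM2l//.
    exact: le_enorm.
  have [->|en0] := eqVneq e 0; first by rewrite mulr0.
  have ep : 0 < e by rewrite lt_neqAle eq_sym en0.
  by rewrite -(ler_pM2r ep) -mulrA -expr2; lra.
have er : e <= r / 8.
  have h : 8 * (L + 1) / r * e <= L.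
    rewrite (le_trans _ ae)// ler_wpM2r// lerDl divr_ge0 ?sqr_ge0// ltW//.
  move: h; rewrite mulrAC ler_pdivrMr// => h.
  rewrite -(@ler_pM2l _ (8 * (L + 1))); last lra.
  apply: (le_trans h); nra.
have eg : L * e < gam.
  have h : (L + 1) ^+ 2 / gam * e <= L.
    rewrite (le_trans _ ae)// ler_wpM2r// lerDr divr_ge0 ?mulr_ge0//; lra.
  move: h; rewrite mulrAC ler_pdivrMr// expr2 => h.
  have h2 : (L + 1) * e <= gam.
    rewrite -(@ler_pM2l _ (L + 1)); last lra.
    rewrite mulrA (le_trans h)// ler_wpM2r ?ltW//; lra.
  have [e00|] := eqVneq e 0; first by rewrite e00 mulr0.
  by move=> en0; have ep : 0 < e by [rewrite lt_neqAle eq_sym en0]; nra.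
(* If [s = 0], comparison with [(x0 + s1 *: v, s1)] would give [gam <= L * e]. *)
have sp : 0 < s.
  rewrite lt_neqAle s0 andbT; apply/negP => /eqP s00.
  have := Pmin _ s1 (lineA s1 _); rewrite lexx ltW// => /(_ isT isT).
  rewrite /Phi/= -/d -s00 mul0r subr0.
  rewrite (_ : x0 + s1 *: v - x0 - s1 *: v = 0); last by rewrite addrAC addrK subrr.
  rewrite -(enorm_sqr 0) enorm0 expr0n/= mulr0 addr0 => H1.
  have xr : `|x - x0| < r by move: Ax; rewrite /A/=; lra.
  have := WL x0 x; rewrite subrr normr0 => /(_ r0 xr) H2.
  have dx : d = x - x0 by rewrite /d -s00 scale0r subr0.
  have H3 : W x0 - W x <= L * e.
    rewrite (le_trans (ler_norm _))// (le_trans H2)// ler_wpM2l//.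
    by rewrite distrC -dx le_enorm.
  have H4 : 0 <= a * inner d d by rewrite mulr_ge0 ?inner_ge0// ltW.
  move: eg; rewrite /gam; lra.
have xr : `|x - x0| <= 5 / 8 * r.
  have -> : x - x0 = d + s *: v by rewrite /d subrK.
  have := line s; rewrite s0 ss1 addrAC subrr add0r => /(_ isT) h.
  have := le_trans (le_enorm d) er.
  have := ler_normD d (s *: v); lra.
(* [xi] is minus the gradient of the penalty at the minimiser. *)
exists x, ((- 2 * a) *: d), a, (r / 8); split; [lra| |exact: ltW|lra|].
- rewrite innerZl leNgt; apply/negP => H.
  pose q := inner v v.
  have q0 : 0 <= q by exact: inner_ge0.
  (* Decrease [s] by [t], which is possible as [s > 0], and divide by [t]; for small [t] the result
     contradicts [c < inner xi v]. *)
  have key t : 0 < t -> t <= s -> 0 <= 2 * a * inner d v + a * t * q + c.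
    move=> t0 ts; have := Pmin x (s - t) Ax; rewrite subr_ge0 ts.
    have -> : s - t <= s1 by lra.
    move=> /(_ isT); rewrite /Phi/= -/d.
    have -> : x - x0 - (s - t) *: v = d + t *: v by rewrite /d; apply/rowP => i; rewrite !mxE; ring.
    rewrite (inner_sqrD d) !innerZr innerZl -/q => H1.
    rewrite -(pmulr_rge0 _ t0); nra.
  pose g := - (2 * a * inner d v + c).
  have g0 : 0 < g by rewrite /g; lra.
  pose t := Num.min s (g / (2 * (a * q + 1))).
  have aq : 0 <= a * q by rewrite mulr_ge0// ltW.
  have t0 : 0 < t by rewrite lt_min sp divr_gt0//; lra.
  have ts : t <= s by rewrite ge_min lexx.
  have tg : t * (2 * (a * q + 1)) <= g.
    by rewrite -ler_pdivlMr ?ge_min ?lexx ?orbT//; lra.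
  by have := key t t0 ts; rewrite /g in tg; nra.
- move=> x' xx'; have := Pmin x' s; rewrite s0 ss1 => /(_ _ isT) H.
  have : `|x' - x0| <= 3 / 4 * r.
    rewrite -[x'](subrK x) -addrA (le_trans (ler_normD _ _))//; lra.
  move=> /H; rewrite /Phi/= -/d.
  have -> : x' - x0 - s *: v = d + (x' - x) by rewrite /d; apply/rowP => i; rewrite !mxE; ring.
  move: (x' - x) => w; rewrite innerZl (inner_sqrD d w); nra.
Unshelve. all: by end_near. Qed.

End FuzzyMeanValue.

(** * Convex hulls of compact sets *)

Section ConvexHull.
Context {R : realType} {n : nat}.
Implicit Types (x y v : 'rV[R]_n) (K C : set 'rV[R]_n).

Lemma convex_setP C : convex_set C <->
  forall x y (t : R), C x -> C y -> 0 <= t <= 1 -> C (t *: x + (1 - t) *: y).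
Proof.
split => [cC x y t Cx Cy /andP[t0 t1]|cC x y l].
  by apply/set_mem; apply: (cC x y (Itv01 t0 t1)); apply/mem_set.
move=> /set_mem Cx /set_mem Cy; apply/mem_set.
apply: (cC x y l%:num Cx Cy); apply/andP; split.
  exact: ge0.
exact: le1.
Qed.

Lemma sub_convex_hull K : K `<=` convex_hull K.
Proof. exact: sub_smallest. Qed.

Lemma convex_hull_min K C : convex_set C -> K `<=` C -> convex_hull K `<=` C.
Proof. by move=> cC KC; apply: smallest_sub. Qed.

Lemma convex_hull_convex K x y (t : R) : convex_hull K x -> convex_hull K y ->
  0 <= t <= 1 -> convex_hull K (t *: x + (1 - t) *: y).
Proof.
move=> Kx Ky t01 C [cC KC].
by apply: (convex_setP C).1 => //; [exact: Kx|exact: Ky].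
Qed.

Lemma convex_hullS K C : K `<=` C -> convex_hull K `<=` convex_hull C.
Proof.
move=> KC; apply: convex_hull_min; first by apply/convex_setP => x y t; exact: convex_hull_convex.
by apply: subset_trans KC _; exact: sub_convex_hull.
Qed.

(** [N] counts terms rather than distinct points: repetitions and zero weights are allowed, so a
    nonempty combination can be padded. *)
Definition combination N K : set 'rV[R]_n :=
  [set x | exists (l : 'I_N -> R) (p : 'I_N -> 'rV[R]_n),
    [/\ forall i, 0 <= l i, \sum_i l i = 1, forall i, K (p i) &
        x = \sum_i l i *: p i]].

(** Combinations of arbitrary length form a convex set: [glue] concatenates two families, with
    weights scaled by [t] and [1 - t]. *)
Lemma convex_hull_combination K x :
  convex_hull K x -> exists N, combination N K x.
Proof.
apply: (@convex_hull_min K [set x | exists N, combination N K x]); last first.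
  move=> y Ky; exists 1, (fun=> 1), (fun=> y).
  by split; rewrite ?big_ord1 ?scale1r.
apply/convex_setP => {}x y t [N [l [p [l0 l1 Kp ->]]]] [M [k [q [k0 k1 Kq ->]]]].
move=> /andP[t0 t1]; exists (N + M)%N.
pose glue T (f : 'I_N -> T) (g : 'I_M -> T) (i : 'I_(N + M)) :=
  match fintype.split i with inl j => f j | inr j => g j end.
have gl T (f : 'I_N -> T) g i : glue T f g (lshift M i) = f i.
  by rewrite /glue; have /= := unsplitK (inl i : 'I_N + 'I_M) => ->.
have gr T (f : 'I_N -> T) g i : glue T f g (rshift N i) = g i.
  by rewrite /glue; have /= := unsplitK (inr i : 'I_N + 'I_M) => ->.
exists (glue R (fun i => t * l i) (fun i => (1 - t) * k i)), (glue _ p q).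
split => [i|| i|].
- by rewrite /glue; case: fintype.split => j; rewrite mulr_ge0// subr_ge0.
- rewrite big_split_ord/=.
  under eq_bigr do rewrite gl; under [X in _ + X]eq_bigr do rewrite gr.
  by rewrite -!mulr_sumr l1 k1 !mulr1 subrKC.
- by rewrite /glue; case: fintype.split => j.
- rewrite big_split_ord/=.
  under [X in _ = X + _]eq_bigr do rewrite !gl -scalerA.
  under [X in _ = _ + X]eq_bigr do rewrite !gr -scalerA.
  by rewrite !scaler_sumr.
Qed.

(** Appending a coordinate 1 to each of the [N.+1] points gives a matrix with more rows than its
    [n + 1] columns, hence a nonzero left kernel vector. The last column makes its entries sum to
    zero, so one of them is positive. *)
Lemma affine_dependence N (p : 'I_N.+1 -> 'rV[R]_n) : (n < N)%N ->
  exists (w : 'I_N.+1 -> R) i,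
    [/\ \sum_j w j = 0, \sum_j w j *: p j = 0 & 0 < w i].
Proof.
move=> nN; pose P : 'M[R]_(N.+1, n + 1) := \matrix_i row_mx (p i) 1.
have kP : kermx P != 0.
  by rewrite -mxrank_eq0 mxrank_ker subn_eq0 -ltnNge (leq_ltn_trans (rank_leq_col _))// addn1.
pose w := nz_row (kermx P).
have w0 : w != 0 by rewrite nz_row_eq0.
have : w *m P = 0 by apply/sub_kermxP; exact: nz_row_sub.
rewrite mulmx_sum_row => wP.
have rE i : row i P = row_mx (p i) 1 by rewrite rowK.
have w1 : \sum_j w 0 j = 0.
  have /(congr1 (fun M : 'rV_(n + 1) => M 0 (rshift n ord0))) := wP.
  rewrite summxE mxE => E; rewrite -[RHS]E; apply: eq_bigr => j _.
  by rewrite rE !mxE (unsplitK (inr _)) mxE eqxx mulr1.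
have wp : \sum_j w 0 j *: p j = 0.
  apply/rowP => k.
  have /(congr1 (fun M : 'rV_(n + 1) => M 0 (lshift 1 k))) := wP.
  rewrite !summxE !mxE => E; rewrite -[RHS]E; apply: eq_bigr => j _.
  by rewrite rE !mxE (unsplitK (inl _)).
have [i wi] : exists i, 0 < w 0 i.
  apply/existsP; rewrite -[X in is_true X]negbK negb_exists; apply/negP => /forallP h.
  case/eqP: w0; apply/rowP => j; rewrite mxE.
  have /eqP := w1; rewrite -oppr_eq0 -sumrN psumr_eq0 => [/allP/(_ j)|i _].
    by rewrite mem_index_enum oppr_eq0 => /(_ isT)/eqP.
  by rewrite oppr_ge0 leNgt h.
by exists (fun j => w 0 j), i.
Qed.

(** Subtracting [t] times an affine dependence changes neither the total weight nor the combined
    point. With [t] the least ratio [l i / w i] over positive [w i], one weight vanishes while the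
    others stay nonnegative. *)
Lemma caratheodory_step N K : (n < N)%N ->
  combination N.+1 K `<=` combination N K.
Proof.
move=> nN x [l [p [l0 l1 Kp ->]]].
have [w [i0 [w1 wp wi0]]] := affine_dependence p nN.
have [i /= wi imin] := @arg_minP _ _ _ i0 (fun i => 0 < w i) (fun i => l i / w i) wi0.
pose t := l i / w i.
have t0 : 0 <= t by rewrite divr_ge0// ltW.
pose l' j := l j - t * w j.
have l'i : l' i = 0 by rewrite /l' /t divfK ?subrr// gt_eqF.
have l'1 : \sum_j l' j = 1 by rewrite sumrB -mulr_sumr w1 mulr0 subr0.
have l'p : \sum_j l' j *: p j = \sum_j l j *: p j.
  under eq_bigr do rewrite scalerBl -scalerA.
  by rewrite sumrB -scaler_sumr wp scaler0 subr0.
exists (l' \o lift i), (p \o lift i); split => [j||j|] /=.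
- rewrite /l' subr_ge0; have [wj|wj] := leP (w (lift i j)) 0.
    by rewrite (le_trans _ (l0 _))// mulr_ge0_le0.
  by rewrite -ler_pdivlMr// imin.
- by move: l'1; rewrite (bigD1_ord i)//= l'i add0r.
- exact: Kp.
- by rewrite -l'p (bigD1_ord i)//= l'i scale0r add0r.
Qed.

Lemma caratheodory K : convex_hull K `<=` combination n.+1 K.
Proof.
move=> x /convex_hull_combination[N].
have [Nn|nN] := leqP N n.+1; last first.
  rewrite -(subnK (ltnW nN)); elim: (N - _)%N => // k IH.
  by rewrite addSn => /caratheodory_step/IH; apply; rewrite addnS ltnS leq_addl.
case: N Nn => [_ [l [p [_ /eqP]]]|N]; first by rewrite big_ord0 eq_sym oner_eq0.
rewrite ltnS => Nn; rewrite -(subnK Nn).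
elim: (n - N)%N => // k IH /IH [l [p [l0 l1 Kp ->]]].
(* A short family is padded by repeating [p ord0] with weight zero. *)
exists (fun i => oapp l 0 (unlift ord_max i)), (fun i => oapp p (p ord0) (unlift ord_max i)).
split => [i||i|]; [by case: unlift => /=| |by case: unlift => /=|].
- rewrite (bigD1_ord ord_max)//= unlift_none/= add0r -[RHS]l1.
  by apply: eq_bigr => i _; rewrite liftK.
- rewrite [RHS](bigD1_ord ord_max)//= unlift_none/= scale0r add0r.
  by apply: eq_bigr => i _; rewrite liftK.
Qed.

(* Points reached from [K] by joining [k] times with a point of [K]; compactness
   is then preserved one segment at a time. *)
Fixpoint segment_hull k K : set 'rV[R]_n := if k is k'.+1 then
  [set p.1 *: p.2.1 + (1 - p.1) *: p.2.2 |
    p in [set` `[0 : R, 1]] `*` (segment_hull k' K `*` K)] else K.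

Lemma compact_segment_hull k K : compact K -> compact (segment_hull k K).
Proof.
move=> cK; elim: k => // k IH.
apply: continuous_compact; last first.
  by apply: compact_setX; [exact: segment_compact|exact: compact_setX].
apply: continuous_subspaceT => -[t [a b]].
have p1 : fst q @[q --> (t, (a, b))] --> t by exact: cvg_fst.
have p2 : snd q @[q --> (t, (a, b))] --> (a, b) by exact: cvg_snd.
have p21 : q.2.1 @[q --> (t, (a, b))] --> a by apply: (cvg_comp _ _ p2); exact: cvg_fst.
have p22 : q.2.2 @[q --> (t, (a, b))] --> b by apply: (cvg_comp _ _ p2); exact: cvg_snd.
apply: cvgD; first exact: cvgZ.
by apply: cvgZ => //; apply: cvgB => //; exact: cvg_cst.
Qed.

Lemma sub_segment_hull k K : K `<=` segment_hull k K.
Proof.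
elim: k => // k IH x Kx; exists (1, (x, x)); last first.
  by rewrite /= subrr scale0r addr0 scale1r.
by split => /=; [rewrite in_itv/= ler01 lexx|split => //; exact: IH].
Qed.

(** In the inductive step all terms but the last, divided by their total weight [t], form a point
    reached in [k] joins; it is then joined to the last point. *)
Lemma combination_segment_hull k K : combination k.+1 K `<=` segment_hull k K.
Proof.
elim: k => [|k IH] x [l [p [l0 l1 Kp ->]]].
  by move: l1; rewrite !big_ord1 => ->; rewrite scale1r.
move: l1; rewrite big_ord_recr/=; set t := \sum_(_ < _) _ => l1; rewrite big_ord_recr/=.
have lt1 : l ord_max = 1 - t by apply/eqP; rewrite eq_sym subr_eq addrC l1.
have t0 : 0 <= t by exact: sumr_ge0.
have t1 : t <= 1 by rewrite -subr_ge0 -lt1.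
(* If [t = 0], normalising is impossible, but all other weights vanish and the combination is its
   last point. *)
have [t00|t00] := eqVneq t 0.
  exists (0, (p ord_max, p ord_max)) => /=.
    by split => /=; [rewrite in_itv/= lexx ler01|split => //; exact: sub_segment_hull].
  rewrite scale0r add0r subr0 lt1 t00 subr0 big1 ?add0r// => i _.
  have /eqP := t00; rewrite psumr_eq0// => /allP/(_ i).
  by rewrite mem_index_enum => /(_ isT)/eqP ->; rewrite scale0r.
exists (t, (t^-1 *: \sum_(i < k.+1) l (widen_ord (leqnSn k.+1) i) *:
    p (widen_ord (leqnSn k.+1) i), p ord_max)) => /=.
  split => /=; first by rewrite in_itv/= t0.
  split => //; apply: IH.
  exists (fun i => t^-1 * l (widen_ord (leqnSn k.+1) i)), (fun i => p (widen_ord (leqnSn k.+1) i)).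
  split => //.
  - by move=> i; rewrite mulr_ge0// invr_ge0.
  - by rewrite -mulr_sumr mulVf.
  - by rewrite scaler_sumr; apply: eq_bigr => i _; rewrite scalerA.
by rewrite scalerA mulfV// scale1r lt1.
Qed.

Lemma segment_hull_sub k K : segment_hull k K `<=` convex_hull K.
Proof.
elim: k => [|k IH]; first exact: sub_convex_hull.
move=> _ [[t [a b]]/= [t01 [/= /IH Ha Hb]] <-].
by apply: convex_hull_convex => //; exact: sub_convex_hull.
Qed.

Lemma compact_convex_hull K : compact K -> compact (convex_hull K).
Proof.
(* The [n.+1] points of Carathéodory's theorem amount to [n] joins. *)
move=> cK; suff -> : convex_hull K = segment_hull n K by exact: compact_segment_hull.
apply/seteqP; split; last exact: segment_hull_sub.
by apply: subset_trans (@combination_segment_hull n K); exact: caratheodory.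
Qed.

(* Separation: the nearest point c of the hull yields the functional c - x. *)
Lemma convex_hull_separation K x : compact K ->
  (forall v, exists2 z, K z & inner z v <= inner x v) -> convex_hull K x.
Proof.
move=> cK H.
(* The zero functional merely shows that [K] is nonempty. *)
have [z Kz _] := H 0.
have [|c /set_mem Cc cmin] := @EVT_min_rV R n (fun c => inner (c - x) (c - x)) (convex_hull K)
    (ex_intro _ z (sub_convex_hull Kz)) (compact_convex_hull cK).
  apply: continuous_subspaceT => c.
  have h : d - x @[d --> c] --> c - x.
    apply: (@cvgB R 'rV[R]_n _ (nbhs c) _ id (fun=> x) c x); [exact: cvg_id|exact: cvg_cst].
  exact: (cvg_inner h h).
pose v := c - x.
(* Moving from [c] towards [y] cannot decrease the squared distance to [x]; the first-order term in
   [t] gives the sign. *)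
have sep y : convex_hull K y -> 0 <= inner v (y - c).
  move=> Ky; rewrite leNgt; apply/negP => lt0.
  pose w := y - c; pose q := inner w w.
  have q0 : 0 <= q by exact: inner_ge0.
  have key t : 0 < t -> t <= 1 -> 0 <= 2 * inner v w + t * q.
    move=> t0 t1.
    have : convex_hull K (t *: y + (1 - t) *: c).
      by apply: convex_hull_convex => //; rewrite ltW.
    move=> /mem_set /cmin.
    have -> : t *: y + (1 - t) *: c - x = v + t *: w.
      by rewrite /v /w; apply/rowP => i; rewrite !mxE; ring.
    rewrite -/v (inner_sqrD v) !innerZr innerZl -/q => h.
    by rewrite -(pmulr_rge0 _ t0); nra.
  pose g := - inner v w.
  have g0 : 0 < g by rewrite oppr_gt0.
  pose t := Num.min 1 (g / (q + 1)).
  have t0 : 0 < t by rewrite lt_min ltr01 divr_gt0//; lra.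
  have t1 : t <= 1 by rewrite ge_min lexx.
  have tg : t * (q + 1) <= g.
    by rewrite -ler_pdivlMr ?ge_min ?lexx ?orbT//; lra.
  by have := key t t0 t1; rewrite /g in tg g0; nra.
(* With [inner z v <= inner x v], the inequality [sep] at [z] leaves [inner v v <= 0], so [x] is its
   own nearest point. *)
have [{}z {}Kz zv] := H v.
have := sep z (sub_convex_hull Kz).
have -> : z - c = (z - x) - v by rewrite /v; apply/rowP => i; rewrite !mxE; ring.
rewrite innerC (innerDl (z - x)) innerDl !innerNl => h.
have v0 : inner v v = 0.
  by apply/le_anti; rewrite inner_ge0 andbT; lra.
have /eqP : enorm v = 0 by rewrite /enorm v0 sqrtr0.
by rewrite enorm_eq0 subr_eq0 => /eqP <-.
Qed.

End ConvexHull.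

(** * The value function *)

(** By monotonicity in [e], the parts of [A] where [P e] holds form a filter base, and compactness
    gives it a cluster point. This replaces the extraction of a convergent subsequence. *)
Lemma compact_cluster_dist {R : realType} {V : normedModType R} (A : set V)
    (P : R -> V -> Prop) :
  compact A -> (forall e e' y, 0 < e -> e <= e' -> P e y -> P e' y) ->
  (forall e, 0 < e -> exists2 y, A y & P e y) ->
  exists2 y, A y & forall e, 0 < e -> exists2 y', P e y' & `|y' - y| < e.
Proof.
move=> cA Pmono PA.
pose F := filter_from [set e : R | 0 < e] (fun e => A `&` [set y | P e y]).
have FF : ProperFilter F.
  apply: filter_from_proper; last by move=> e /PA[y Ay Py]; exists y.
  apply: filter_from_filter; first by exists 1 => /=; exact: ltr01.
  move=> e e' /= e0 e'0; exists (Num.min e e'); first by rewrite /= lt_min e0.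
  have m0 : 0 < Num.min e e' by rewrite lt_min e0.
  move=> y [Ay Py]; split; split => //=; apply: Pmono Py => //.
    by rewrite ge_min lexx.
  by rewrite ge_min lexx orbT.
have [|y [Ay cly]] := cA F FF.
  by exists 1 => /=; [exact: ltr01|move=> y []].
exists y => // e e0.
have [||y' [[_ Py'] yy']] := cly (A `&` [set y | P e y]) [set y' | `|y' - y| < e].
- by exists e.
- exact: near_dist.
by exists y'.
Qed.

Lemma closed_dist {R : realType} {V : normedModType R} (A : set V) :
  (forall y, (forall e, 0 < e -> exists2 y', A y' & `|y' - y| < e) -> A y) ->
  closed A.
Proof.
move=> H y cly; apply: H => e e0.
by have [y' [Ay' yy']] := cly _ (near_dist y e0); exists y'.
Qed.

Section Danskin.
Context {R : realType} {n m : nat} (f : 'rV[R]_n * 'rV[R]_m -> R)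
  (Gamma : set 'rV[R]_m) (xbar u : 'rV[R]_n) (U : set 'rV[R]_n)
  (f_cont : continuous f) (Gamma_closed : closed Gamma) (U_nbhs : nbhs xbar U)
  (grad_ex : forall x y, U x -> Gamma y ->
     differentiable (fun x' => f (x', y)) x)
  (grad_cont : {within U `*` Gamma,
     continuous (fun p => gradient (fun x' => f (x', p.2)) p.1)}).
Local Notation V := (value_fun f Gamma).
Local Notation S := (sol_map f Gamma).
Local Notation grad x y := (gradient (fun x' => f (x', y)) x).
Implicit Types (x z xi v : 'rV[R]_n) (y : 'rV[R]_m) (e : R).

Lemma value_le x y : Gamma y -> (V x <= (f (x, y))%:E)%E.
Proof. by move=> Gy; apply: ereal_inf_lbound; exists y. Qed.

Lemma sol_val x y : S x y -> fine (V x) = f (x, y).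
Proof. by case=> _ <-. Qed.

(** The solution [y'] makes [V x] finite, so that [fine] does not return its default value. *)
Lemma value_fine_le x y y' : Gamma y -> S x y' -> fine (V x) <= f (x, y).
Proof.
move=> Gy Sy; rewrite (sol_val Sy) -lee_fin; case: Sy => _ ->.
exact: value_le.
Qed.

Lemma U_ball : exists2 r, 0 < r & forall x, `|x - xbar| < r -> U x.
Proof.
have /nbhs_ballP[r /= r0 h] := U_nbhs; exists r => // x xr; apply: h.
by rewrite -ball_normE/= distrC.
Qed.

Lemma frechet_sol x xi y : U x -> S x y -> frechet_subdiff V x xi ->
  xi = grad x y.
Proof.
move=> Ux [Gy fV] xiV; apply: (frechet_gradient xiV); first exact: grad_ex.
  by rewrite fV.
  by apply: (@nearW _ (nbhs x)) => x'; exact: value_le.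
Qed.

Lemma f_near x y e : 0 < e -> exists2 d, 0 < d &
  forall x' y', `|x' - x| < d -> `|y' - y| < d -> `|f (x', y') - f (x, y)| < e.
Proof.
move=> e0; have fc : f p @[p --> (x, y)] --> f (x, y) by exact: f_cont.
have /nbhs_ballP[d /= d0 h] : \forall p \near (x, y), `|f (x, y) - f p| < e.
  by move/cvgrPdist_lt: fc; exact.
exists d => // x' y' hx hy; rewrite distrC; apply: h.
by split => /=; rewrite -ball_normE/= distrC.
Qed.

Lemma grad_near y e : Gamma y -> 0 < e -> exists2 d, 0 < d &
  forall x' y', `|x' - xbar| < d -> `|y' - y| < d -> Gamma y' ->
    `|grad x' y' - grad xbar y| < e.
Proof.
move=> Gy e0; have [r r0 rU] := U_ball.
have UG : (U `*` Gamma) (xbar, y) by split => //; exact: nbhs_singleton.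
have gc := (@subspace_continuousP _ _ _ _).1 grad_cont _ UG.
have /nbhs_ballP[d /= d0 h] : \forall p \near (xbar, y), (U `*` Gamma) p ->
    `|grad xbar y - grad p.1 p.2| < e.
  by move/cvgrPdist_lt: gc; exact.
exists (Num.min r d); first by rewrite lt_min r0.
move=> x' y'; rewrite !lt_min => /andP[xr xd] /andP[_ yd] Gy'.
rewrite distrC; apply: (h (x', y')).
  by split => /=; rewrite -ball_normE/= distrC.
by split => //=; exact: rU.
Qed.

Lemma grad_bounded (Omega : set 'rV[R]_m) : compact Omega ->
  exists r M, [/\ 0 < r, 0 <= M, forall x, `|x - xbar| < r -> U x &
    forall x y, `|x - xbar| < r -> Gamma y -> Omega y -> `|grad x y| <= M].
Proof.
move=> cO; have [r r0 rU] := U_ball.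
have r20 : 0 < r / 2 by rewrite divr_gt0.
have cK : compact ([set x | `|x - xbar| <= r / 2] `*` (Omega `&` Gamma)).
  apply: compact_setX; first exact: compact_norm_ball.
  exact: compact_closedI.
have sub : [set x | `|x - xbar| <= r / 2] `*` (Omega `&` Gamma) `<=` U `*` Gamma.
  by move=> [x y] [/= xr [_ Gy]]; split => //=; apply: rU; lra.
have /compact_bounded[M [_ hM]] := continuous_compact (continuous_subspaceW sub grad_cont) cK.
exists (r / 2), (Num.max 0 (M + 1)); split => //.
- by rewrite le_max lexx.
- by move=> x xr; apply: rU; lra.
- move=> x y xr Gy Oy; rewrite le_max (hM (M + 1)) ?orbT ?ltrDl//.
  by exists (x, y) => //; split => //=; exact: ltW.
Qed.

Lemma dir_nbhd0 eps delta : 0 < eps -> dir_nbhd eps delta u 0.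
Proof. by move=> e0; split; rewrite ?enorm0 ?scaler0 ?scale0r ?subr0 ?enorm0 ?mulr0 ?mul0r. Qed.

Lemma dir_nbhdS eps eps' delta z : eps <= eps' ->
  dir_nbhd eps delta u z -> dir_nbhd eps' delta u z.
Proof. by move=> ee' [ze zd]; split => //; exact: lt_le_trans ee'. Qed.

(** At [z = 0] the hypothesis yields a solution [y0] in [Omega]. Continuity of [f] keeps
    [f (xbar + z, y0)], which bounds [V (xbar + z)], below [V xbar + eps], so solutions in [Omega]
    exist for every [z] in a smaller directional neighbourhood. *)
Lemma inf_compact_data (Omega : set 'rV[R]_m) :
  restricted_inf_compact V S xbar u Omega ->
  exists r L M eps delta, [/\ 0 <= L, 0 < eps, 0 < delta,
    (forall x, `|x - xbar| < r -> U x) /\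
    (forall x y, `|x - xbar| < r -> Gamma y -> Omega y -> `|grad x y| <= M) &
    (forall z, dir_nbhd eps delta u z ->
       `|z| < r /\ exists2 y, S (xbar + z) y & Omega y) /\
    (forall z z', dir_nbhd eps delta u z -> dir_nbhd eps delta u z' ->
      `|fine (V (xbar + z)) - fine (V (xbar + z'))| <= L * `|z - z'|)].
Proof.
move=> [cO Vfin [eps [delta [eps0 delta0 H]]]].
have [r [M [r0 M0 rU gM]]] := grad_bounded cO.
have := H _ (dir_nbhd0 delta eps0); rewrite addr0.
rewrite -{1}[V xbar]adde0 lteD2lE// lte_fin => /(_ eps0)[y0 [[Gy0 fy0] Oy0]].
have [d d0 fd] := f_near xbar y0 eps0.
pose eps' := Num.min eps (Num.min d r).
have eps'0 : 0 < eps' by rewrite !lt_min eps0 d0.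
have small z : dir_nbhd eps' delta u z -> `|z| < r /\ exists2 y, S (xbar + z) y & Omega y.
  move=> zD; have : `|z| < eps' by case: zD => ze _; exact: le_lt_trans (le_enorm z) ze.
  rewrite !lt_min => /and3P[_ zd zr]; split => //.
  have Vz : (V (xbar + z)%R < V xbar + eps%:E)%E.
    rewrite (le_lt_trans (value_le _ Gy0))// -fy0 -EFinD lte_fin -ltrBlDl.
    rewrite (le_lt_trans (ler_norm _))//.
    by apply: fd; rewrite ?subrr ?normr0// addrAC subrr add0r.
  have [|y [Sy Oy]] := H z _ Vz; last by exists y.
  by apply: dir_nbhdS zD; rewrite ge_min lexx.
have L0 : 0 <= n%:R * M by rewrite mulr_ge0.
(* A solution [y] at [xbar + z] serves as competitor at [xbar + z']. The segment between the two
   points may leave the directional neighbourhood, but it stays in the ball where the gradients are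
   bounded. *)
have one z z' : dir_nbhd eps' delta u z -> dir_nbhd eps' delta u z' ->
    fine (V (xbar + z')) - fine (V (xbar + z)) <= n%:R * M * `|z - z'|.
  move=> /small[zr [y Sy Oy]] /small[zr' [y' Sy' _]].
  have Gy : Gamma y by case: Sy.
  rewrite (sol_val Sy) (le_trans (lerB (value_fine_le Gy Sy') (lexx _)))//.
  rewrite (le_trans (ler_norm _))// distrC.
  have -> : z - z' = (xbar + z) - (xbar + z').
    by apply/rowP => i; rewrite !mxE; ring.
  apply: (@lipschitz_ball _ _ (fun x => f (x, y)) xbar r) => [x xr||].
  - by split; [exact: grad_ex (rU _ xr) Gy|exact: gM].
  - by rewrite addrAC subrr add0r.
  - by rewrite addrAC subrr add0r.
exists r, (n%:R * M), M, eps', delta; split => //; split => // z z' zD zD'.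
rewrite ler_norml lerNl opprB one//= (le_trans (one _ _ zD' zD))//.
by rewrite distrC.
Qed.

Lemma inf_compact_lipschitz (Omega : set 'rV[R]_m) :
  restricted_inf_compact V S xbar u Omega -> dir_lipschitz V xbar u.
Proof.
move=> /inf_compact_data[r [L [M [eps [delta [L0 e0 d0 _ [HS HL]]]]]]].
exists L, eps, delta; split => // [z /HS[_ [y [_ <-] _]]//|z z' zD zD'].
rewrite (le_trans (HL _ _ zD zD'))// ler_wpM2l//.
have -> : (xbar + z) - (xbar + z') = z - z'.
  by apply/rowP => i; rewrite !mxE; ring.
exact: le_enorm.
Qed.

Lemma inf_compact_dir (Omega : set 'rV[R]_m) :
  restricted_inf_compact V S xbar u Omega ->
  exists e0 L M, [/\ 0 < e0, 0 <= L,
    forall z, dir_ball e0 u z -> U (xbar + z) /\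
      exists2 y, S (xbar + z) y & Omega y,
    forall z, dir_ball e0 u z ->
      `|fine (V (xbar + z)) - fine (V xbar)| <= L * `|z| /\
      (forall y, Gamma y -> Omega y -> `|grad (xbar + z) y| <= M) &
    forall z z', dir_ball e0 u z -> dir_ball e0 u z' ->
      `|fine (V (xbar + z)) - fine (V (xbar + z'))| <= L * `|z - z'|].
Proof.
move=> /inf_compact_data[r [L [M [eps [delta [L0 eps0 d0 [rU rM] [HS HL]]]]]]].
have [e0 e00 sub] := dir_ball_sub_nbhd u eps0 d0.
exists e0, L, M; split => // [z /sub zD|z /sub zD|z z' /sub zD /sub zD'].
- have [zr ?] := HS _ zD; split => //.
  by apply: rU; rewrite addrAC subrr add0r.
- split=> [|y Gy Oy].
    by have := HL _ _ zD (dir_nbhd0 delta eps0); rewrite addr0 subr0.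
  have [zr ?] := HS _ zD.
  by apply: rM => //; rewrite addrAC subrr add0r.
- exact: HL.
Qed.

(** * Directional limits under restricted inf-compactness *)

Section InfCompact.
Context (Omega : set 'rV[R]_m)
  (ric : restricted_inf_compact V S xbar u Omega).

Lemma value_fin : V xbar \is a fin_num. Proof. by case: ric. Qed.

(** [Q] carries the information that must survive the limit. The cluster point solves the problem at
    [xbar] because the values of [f] and of [V] both converge. *)
Lemma dir_sol_limit (Q : R -> 'rV[R]_n -> 'rV[R]_m -> Prop) :
  (forall e e' z y, 0 < e -> e <= e' -> Q e z y -> Q e' z y) ->
  (forall e, 0 < e -> exists z y,
     [/\ dir_ball e u z, S (xbar + z) y, Omega y & Q e z y]) ->
  exists y, [/\ dir_sol S xbar u y, Omega y & forall e, 0 < e -> exists z y',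
    [/\ dir_ball e u z, S (xbar + z) y', `|y' - y| < e & Q e z y']].
Proof.
move=> Qmono HQ.
have cOG : compact (Omega `&` Gamma).
  by apply: compact_closedI => //; case: ric.
pose P e y := exists z, [/\ dir_ball e u z, S (xbar + z) y & Q e z y].
have [|e e0|y [Oy Gy] Hy] := @compact_cluster_dist _ _ _ P cOG.
- move=> e e' y e0 ee' [z [zD Sy Qy]]; exists z; split => //.
    exact: dir_ballS zD.
  exact: Qmono Qy.
- have [z [y [zD Sy Oy Qy]]] := HQ e e0.
  by exists y; [split => //; case: Sy|exists z].
have {}Hy e : 0 < e -> exists z y',
    [/\ dir_ball e u z, S (xbar + z) y', `|y' - y| < e & Q e z y'].
  by move=> /Hy[y' [z [zD Sy Qy]] yy']; exists z, y'.
exists y; split => //; apply/dir_solP; split; last first.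
  by move=> e /Hy[z [y' [zD Sy yy' _]]]; exists z, y'.
split => //; rewrite -(fineK value_fin); congr EFin.
apply/eqP; rewrite -subr_eq0 -normr_le0; apply/ler_addgt0Pl => e e0; rewrite addr0.
have [e1 [L [M [e10 L0 _ HL _]]]] := inf_compact_dir ric.
have e20 : 0 < e / 2 by rewrite divr_gt0.
have [d d0 fd] := f_near xbar y e20.
have L10 : 0 < L + 1 by lra.
have [e2 e2p he2] := dir_ball_small u (divr_gt0 e20 L10).
have [e3 e3p he3] := dir_ball_small u d0.
have [|z [y' [zD Sy yy' _]]] := Hy (Num.min (Num.min e1 e2) (Num.min e3 d)).
  by rewrite !lt_min e10 e2p e3p d0.
have zD1 : dir_ball e1 u z by apply: dir_ballS zD; rewrite !ge_min lexx.
have zD2 : dir_ball e2 u z by apply: dir_ballS zD; rewrite !ge_min lexx !orbT.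
have zD3 : dir_ball e3 u z by apply: dir_ballS zD; rewrite !ge_min lexx !orbT.
have yd : `|y' - y| < d by apply: (lt_le_trans yy'); rewrite !ge_min lexx !orbT.
have h1 : `|f (xbar + z, y') - f (xbar, y)| < e / 2.
  by apply: fd => //; rewrite addrAC subrr add0r; exact: he3.
have [h2 _] := HL _ zD1; rewrite (sol_val Sy) in h2.
have h3 : L * `|z| <= e / 2.
  have := he2 _ zD2; rewrite ltr_pdivlMr// => h; rewrite (le_trans _ (ltW h))//.
  by rewrite mulrC ler_wpM2l//; lra.
have -> : f (xbar, y) - fine (V xbar) =
  (f (xbar + z, y') - fine (V xbar)) - (f (xbar + z, y') - f (xbar, y)) by ring.
by rewrite (le_trans (ler_normB _ _))//; lra.
Qed.

Lemma dir_sol_neq0 : exists2 y, dir_sol S xbar u y & Omega y.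
Proof.
have [e0 [L [M [e00 L0 HS _ _]]]] := inf_compact_dir ric.
have [//|e e_gt0|y [Sy Oy _]] := @dir_sol_limit (fun _ _ _ => True); last by exists y.
have [z zD] := @dir_ball_center _ _ (Num.min e e0) u ltac:(by rewrite lt_min e_gt0).
have [|_ [y Sy Oy]] := HS z; first by apply: dir_ballS zD; rewrite ge_min lexx orbT.
by exists z, y; split => //; apply: dir_ballS zD; rewrite ge_min lexx.
Qed.

Lemma dir_subdiff_sub :
  dir_subdiff V xbar u `<=`
    \bigcup_(y in dir_sol S xbar u `&` Omega) [set grad xbar y].
Proof.
move=> xi /(dir_subdiffP _ _ value_fin) H.
have [e0 [L [M [e00 L0 HS _ _]]]] := inf_compact_dir ric.
(* Taking for [Q] the closeness of the gradient to [xi] ties the limit [y] to [xi]. *)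
have [||y [Sy Oy Hy]] := @dir_sol_limit (fun e z y => `|grad (xbar + z) y - xi| < e).
- by move=> e e' z y _ ee' /lt_le_trans; apply.
- move=> e e_gt0; have m0 : 0 < Num.min e e0 by rewrite lt_min e_gt0.
  have [z [xi' [zD Fxi' xixi' _]]] := H _ m0.
  have [|Uz [y Sy Oy]] := HS z; first by apply: dir_ballS zD; rewrite ge_min lexx orbT.
  exists z, y; split => //; first by apply: dir_ballS zD; rewrite ge_min lexx.
  rewrite -(frechet_sol Uz Sy Fxi') (lt_le_trans xixi')// ge_min lexx//.
exists y => //=; apply/eqP; rewrite -subr_eq0 -normr_le0.
apply/ler_addgt0Pl => e e_gt0; rewrite addr0.
have Gy : Gamma y by case: Sy => -[].
have e20 : 0 < e / 2 by rewrite divr_gt0.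
have [d d0 gd] := grad_near Gy e20.
have [e1 e1p he1] := dir_ball_small u d0.
have [|z [y' [zD Sy' yy' gz]]] := Hy (Num.min e1 (Num.min d (e / 2))).
  by rewrite !lt_min e1p d0.
move: gz yy'; rewrite !lt_min => /and3P[_ _ gz] /and3P[_ yy' _].
have := gd (xbar + z) y'; rewrite addrAC subrr add0r => /(_ (he1 _ _) yy').
have Gy' : Gamma y' by case: Sy'.
move=> /(_ (dir_ballS _ zD) Gy'); rewrite ge_min lexx => /(_ isT) h.
have -> : xi - grad xbar y = (grad (xbar + z) y' - grad xbar y) - (grad (xbar + z) y' - xi).
  by apply/rowP => i; rewrite !mxE; ring.
by rewrite (le_trans (ler_normB _ _))//; lra.
Qed.

Lemma frechet_below y v e : dir_sol S xbar u y -> 0 < e -> exists z xi,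
  [/\ dir_ball e u z, frechet_subdiff V (xbar + z) xi &
      inner xi v <= inner (grad xbar y) v + e].
Proof.
move=> Sy e_gt0.
have Gy : Gamma y by case: Sy => -[].
have [e0 [L [M [e00 L0 HS _ HL]]]] := inf_compact_dir ric.
pose K := n%:R * (`|v| + 1); have K0 : 0 <= K by rewrite mulr_ge0// addr_ge0.
have eK : 0 < e / 2 / (K + 1) by rewrite !divr_gt0//; lra.
have [d d0 gd] := grad_near Gy eK.
have [e1 e1p he1] := dir_ball_small u d0.
have [e2 [e2p e2e e2e0]] : exists e2, [/\ 0 < e2, e2 <= e & e2 <= e0].
  by exists (Num.min e e0); rewrite lt_min e_gt0 !ge_min !lexx orbT.
have [_ /(_ (Num.min e1 (Num.min d e2)))] := (dir_solP _ _ _ _).1 Sy.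
rewrite !lt_min e1p d0 e2p => /(_ isT)[z [y' [zD Sy' yy']]].
have Gy' : Gamma y' by case: Sy'.
have zD1 : dir_ball e1 u z by apply: dir_ballS zD; rewrite !ge_min lexx.
have zD2 : dir_ball e2 u z by apply: dir_ballS zD; rewrite !ge_min lexx !orbT.
have yd : `|y' - y| < d by apply: (lt_le_trans yy'); rewrite !ge_min lexx !orbT.
have sub2 z' : dir_ball e2 u z' -> dir_ball e0 u z'.
  exact: dir_ballS.
(* Openness provides a full ball around [xbar + z] on which [V] is Lipschitz, as the fuzzy mean
   value inequality requires. *)
have [r r0 hr] := dir_ball_open zD2.
pose x0 := xbar + z.
have gclose : `|grad x0 y' - grad xbar y| < e / 2 / (K + 1).
  by apply: gd => //; rewrite addrAC subrr add0r; exact: he1.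
have gv : inner (grad x0 y') v < inner (grad xbar y) v + e.
  rewrite -ltrBlDl -[- inner _ v]innerNl -innerDl (le_lt_trans (ler_norm _))//.
  rewrite (le_lt_trans (inner_le _ _))//.
  have h : n%:R * (`|grad x0 y' - grad xbar y| * `|v|) <= K * `|grad x0 y' - grad xbar y|.
    rewrite /K -mulrA ler_wpM2l// mulrC ler_wpM2r//; lra.
  rewrite (le_lt_trans h)//; move: gclose; rewrite ltr_pdivlMr; last lra.
  have : 0 <= `|grad x0 y' - grad xbar y| by [].
  nra.
have dv : differentiable (fun x => f (x, y')) x0.
  by apply: grad_ex => //; have [] := HS z (sub2 _ zD2).
pose c := inner (grad xbar y) v + e.
have [s [s0 sv fs]] : exists s, [/\ 0 < s, s * `|v| <= r / 2 &
    s^-1 * (f (s *: v + x0, y') - f (x0, y')) < c].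
  apply: (@filter_ex _ (0^'+ : set_system R)); near=> s; split.
  - by near: s; exact: nbhs_right_gt.
  - have v0 : 0 < `|v| + 1 by rewrite ltr_wpDl.
    have : s < r / 2 / (`|v| + 1).
      by near: s; apply: nbhs_right_lt; rewrite !divr_gt0.
    rewrite ltr_pdivlMr// => /ltW; apply: le_trans.
    by rewrite ler_wpM2l ?lerDl// ltW//; near: s; exact: nbhs_right_gt.
  - by near: s; apply: (cvgr_lt _ (cvg_derive_right dv)).
have W_lip x x' : `|x - x0| < r -> `|x' - x0| < r ->
    `|fine (V x) - fine (V x')| <= L * `|x - x'|.
  move=> xr xr'; have := HL (x - xbar) (x' - xbar).
  rewrite ![xbar + _]addrC !subrK.
  have -> : x - xbar - (x' - xbar) = x - x' by apply/rowP => i; rewrite !mxE; ring.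
  by apply; apply/sub2/hr; rewrite -addrA -opprD.
have in_ball x : `|x - x0| < r -> exists2 z', dir_ball e2 u z' & x = xbar + z'.
  move=> xr; exists (x - xbar); last by rewrite addrC subrK.
  by apply: hr; rewrite -addrA -opprD.
have Vfin x : `|x - x0| < r -> V x \is a fin_num.
  by move=> /in_ball[z' /sub2/HS[_ [y1 [_ E] _]] ->]; rewrite -E.
(* [V] lies below [f] with [y'] fixed and touches it at [x0], so the choice of [s] bounds the
   increase of [V] too. *)
have W_less : fine (V (x0 + s *: v)) < fine (V x0) + s * c.
  have xr : `|x0 + s *: v - x0| < r.
    by rewrite addrAC subrr add0r normrZ gtr0_norm//; lra.
  rewrite (sol_val Sy') addrC (le_lt_trans (y := f (s *: v + x0, y')))//.
    rewrite -lee_fin fineK; first exact: value_le.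
    by rewrite addrC; exact: Vfin.
  rewrite -ltrBlDl -(ltr_pM2l (x := s^-1)) ?invr_gt0// mulKf ?gt_eqF//.
have [x [xi [a [rho [xr xiv a0 rho0 Hx]]]]] :=
  fuzzy_mean_value r0 L0 W_lip s0 sv W_less.
have [z' zD' xE] := in_ball x xr.
exists z', xi; split => //; first exact: dir_ballS zD'.
rewrite -xE; apply: (@quadratic_frechet _ _ _ _ _ a (Num.min rho (r - `|x - x0|))) => //.
  by rewrite lt_min rho0 subr_gt0.
move=> x'; rewrite lt_min => /andP[x'rho x'r]; split; last exact: Hx.
apply: Vfin; rewrite -[x'](subrK x) -addrA (le_lt_trans (ler_normD _ _))//; lra.
Unshelve. all: by end_near. Qed.

Lemma frechet_bounded : exists e0 M, 0 < e0 /\ forall z xi,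
  dir_ball e0 u z -> frechet_subdiff V (xbar + z) xi -> `|xi| <= M.
Proof.
have [e0 [L [M [e00 L0 HS HM _]]]] := inf_compact_dir ric.
exists e0, M; split => // z xi zD Fxi.
have [Uz [y Sy Oy]] := HS z zD.
by rewrite (frechet_sol Uz Sy Fxi); apply: (HM z zD).2 => //; case: Sy.
Qed.

(** The subgradients from [frechet_below] are bounded, so they cluster as [e] tends to 0; the
    Lipschitz estimate makes the values of [V] converge. *)
Lemma dir_subdiff_below y v : dir_sol S xbar u y ->
  exists2 xi, dir_subdiff V xbar u xi & inner xi v <= inner (grad xbar y) v.
Proof.
move=> Sy.
have [e0 [M [e00 HM]]] := frechet_bounded.
have [e1 [L [M' [e10 L0 _ HL _]]]] := inf_compact_dir ric.
pose P e xi := exists z, [/\ dir_ball e u z, frechet_subdiff V (xbar + z) xi &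
  inner xi v <= inner (grad xbar y) v + e].
have M10 : 0 < `|M| + 1 by rewrite ltr_wpDl.
have [|e e_gt0|xi _ Hxi] := @compact_cluster_dist _ _ _ P (@compact_norm_ball _ _ 0 _ M10).
- move=> e e' xi _ ee' [z [zD Fz xiv]]; exists z; split => //.
    exact: dir_ballS zD.
  by rewrite (le_trans xiv)// lerD2l.
- have m0 : 0 < Num.min e e0 by rewrite lt_min e_gt0.
  have [z [xi [zD Fz xiv]]] := frechet_below v Sy m0.
  exists xi => /=.
    rewrite subr0 (le_trans (HM z xi _ Fz))//.
      by apply: dir_ballS zD; rewrite ge_min lexx orbT.
    by have := ler_norm M; lra.
  exists z; split => //; first by apply: dir_ballS zD; rewrite ge_min lexx.
  by rewrite (le_trans xiv)// lerD2l ge_min lexx.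
exists xi.
  apply/(dir_subdiffP _ _ value_fin) => e e_gt0.
  have eL : 0 < e / (L + 1) by rewrite divr_gt0//; lra.
  have [e2 e20 he2] := dir_ball_small u eL.
  have [|xi' [z [zD Fz _]] xixi'] := Hxi (Num.min e (Num.min e1 e2)).
    by rewrite !lt_min e_gt0 e10.
  exists z, xi'; split => //.
  - by apply: dir_ballS zD; rewrite ge_min lexx.
  - by rewrite (lt_le_trans xixi')// ge_min lexx.
  - have [|h _] := HL z; first by apply: dir_ballS zD; rewrite !ge_min lexx orbT.
    have := he2 z; rewrite ltr_pdivlMr; last lra.
    move=> /(_ (dir_ballS _ zD)); rewrite !ge_min lexx !orbT => /(_ isT).
    apply: le_lt_trans; rewrite (le_trans h)// mulrC ler_wpM2l//; lra.
apply/ler_addgt0Pr => e e_gt0.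
(* As [K >= 1], the slack [e / 2 / K] inherited from [P] is at most [e / 2]; replacing [xi'] by [xi]
   costs another [e / 2] along [v]. *)
pose K := n%:R * `|v| + 1; have K0 : 0 < K by rewrite ltr_wpDl// mulr_ge0.
have [|xi' [z [_ _ xiv]] xixi'] := Hxi (e / 2 / K); first by rewrite !divr_gt0.
have -> : xi = (xi - xi') + xi' by rewrite subrK.
rewrite innerDl.
have h1 : inner (xi - xi') v <= e / 2.
  rewrite (le_trans (ler_norm _))// (le_trans (inner_le _ _))//.
  move: xixi'; rewrite distrC ltr_pdivlMr// /K; have : 0 <= `|xi - xi'| by []; nra.
have h2 : e / 2 / K <= e / 2.
  rewrite ler_pdivrMr// ler_peMr//; first by rewrite ltW// divr_gt0.
  by rewrite /K lerDr mulr_ge0.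
lra.
Qed.

(** Boundedness is inherited from the nearby Fréchet subgradients; closedness is a diagonal
    argument, as a directional subgradient close to [xi] is itself close to Fréchet subgradients. *)
Lemma compact_dir_subdiff : compact (dir_subdiff V xbar u).
Proof.
have [e0 [M [e00 HM]]] := frechet_bounded.
apply: bounded_closed_compact.
  exists (M + 1); split; first exact: num_real.
  move=> B MB xi /(dir_subdiffP _ _ value_fin) H.
  have m0 : 0 < Num.min 1 e0 by rewrite lt_min ltr01.
  have [z [xi' [zD Fz xixi' _]]] := H _ m0.
  have : `|xi' - xi| < 1 by rewrite (lt_le_trans xixi')// ge_min lexx.
  have : `|xi'| <= M.
    by apply: HM Fz; apply: dir_ballS zD; rewrite ge_min lexx orbT.
  have := ler_normB xi' (xi' - xi); rewrite subKr; move=> /=; lra.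
apply: closed_dist => xi H; apply/(dir_subdiffP _ _ value_fin) => e e_gt0.
have e20 : 0 < e / 2 by rewrite divr_gt0.
have [xi1 /(dir_subdiffP _ _ value_fin)/(_ _ e20)] := H _ e20.
move=> [z [xi' [zD Fz xixi' Vz]]] xi1xi; exists z, xi'; split => //.
- by apply: dir_ballS zD; lra.
- by have := ler_distD xi1 xi' xi; lra.
- lra.
Qed.

End InfCompact.

(** If no directional ball worked, a bad point in each ball of radius [k.+1%:R^-1] would give a
    directionally convergent sequence whose solutions all stay away from [ybar]. *)
Lemma inner_semicontinuous_inf_compact ybar (r : R) : 0 < r ->
  dir_inner_semicontinuous S xbar ybar u ->
  restricted_inf_compact V S xbar u [set y | `|y - ybar| <= r].
Proof.
move=> r0 [Sybar isc]; split; first exact: compact_norm_ball.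
  by have [_ <-] := Sybar.
have [e e0 He] : exists2 e, 0 < e & forall z, dir_ball e u z ->
    exists2 y, S (xbar + z) y & `|y - ybar| <= r.
  apply: contrapT => /forall2NP H.
  have /choice[zs hzs] : forall k : nat, exists z, dir_ball k.+1%:R^-1 u z /\
      ~ exists2 y, S (xbar + z) y & `|y - ybar| <= r.
    move=> k; have [/negP|/existsNP[z /not_implyP[zD h]]] := H k.+1%:R^-1.
      by rewrite invr_gt0 ltr0Sn.
    by exists z.
  have [|ys [Sys ysc]] := isc (fun k => xbar + zs k).
    by apply: dir_ball_cvg => k; rewrite addrAC subrr add0r; case: (hzs k).
  have [k [Sk yk]] : exists k, S (xbar + zs k) (ys k) /\ `|ys k - ybar| < r.
    apply: (@filter_ex _ \oo); near=> k; split; first by near: k.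
    by rewrite distrC; near: k; move/cvgrPdist_lt: ysc; exact.
  by case: (hzs k) => _; apply; exists (ys k) => //; exact: ltW.
have [eps [delta [eps0 delta0 sub]]] := nbhd_sub_dir_ball u e0.
exists eps, delta; split => // z zD _.
(* [dir_ball e u] may omit [0], where [ybar] itself is a solution. *)
have [->|z0] := eqVneq z 0.
  by exists ybar; rewrite addr0; split => //=; rewrite subrr normr0 ltW.
by have [y Sy yr] := He z (sub z zD z0); exists y.
Unshelve. all: by end_near. Qed.

End Danskin.

Unset Implicit Arguments.

Theorem proposition4p4 (R : realType) (n m : nat)
    (f : 'rV[R]_n * 'rV[R]_m -> R) (Gamma : set 'rV[R]_m)
    (xbar u : 'rV[R]_n) (U : set 'rV[R]_n)
    (f_cont : continuous f)
    (Gamma_closed : closed Gamma)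
    (U_nbhs : nbhs xbar U)
    (grad_ex : forall x y, U x -> Gamma y ->
       differentiable (fun x' => f (x', y)) x)
    (grad_cont : {within U `*` Gamma,
       continuous (fun p => gradient (fun x' => f (x', p.2)) p.1)}) :
  let V := value_fun f Gamma in
  let S := sol_map f Gamma in
  let grad_x := fun y => gradient (fun x' => f (x', y)) xbar in
  (forall Omega : set 'rV[R]_m,
     restricted_inf_compact V S xbar u Omega ->
     [/\ dir_lipschitz V xbar u,
         dir_subdiff V xbar u !=set0,
         dir_subdiff V xbar u `<=`
           \bigcup_(y in dir_sol S xbar u `&` Omega) [set grad_x y] &
         dir_clarke_subdiff V xbar u =
           convex_hull [set grad_x y | y in dir_sol S xbar u `&` Omega]]) /\
  (forall ybar : 'rV[R]_m,
     dir_inner_semicontinuous S xbar ybar u ->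
     dir_lipschitz V xbar u /\
     dir_subdiff V xbar u = [set grad_x ybar]).
Proof.
move=> V S grad_x; split => [C ric|ybar isc].
  have sub := dir_subdiff_sub f_cont Gamma_closed U_nbhs grad_ex grad_cont ric.
  have below := dir_subdiff_below f_cont Gamma_closed U_nbhs grad_ex grad_cont ric.
  split => //.
  - exact: (inf_compact_lipschitz f_cont Gamma_closed U_nbhs grad_ex grad_cont ric).
  - have [y Sy _] := dir_sol_neq0 f_cont Gamma_closed U_nbhs grad_ex grad_cont ric.
    by have [xi Vxi _] := below y 0 Sy; exists xi.
  - apply/seteqP; split.
      by apply: convex_hullS => xi /sub [y Sy ->]; exists y.
    apply: convex_hull_min.
      by apply/convex_setP => x y t; exact: convex_hull_convex.
    move=> _ [y [Sy _] <-]; apply: convex_hull_separation => [|v].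
      exact: (compact_dir_subdiff f_cont Gamma_closed U_nbhs grad_ex grad_cont ric).
    exact: below.
have ric r (r0 : 0 < r) := inner_semicontinuous_inf_compact r0 isc.
have Gybar : Gamma ybar by case: isc => -[].
split.
  exact: (inf_compact_lipschitz f_cont Gamma_closed U_nbhs grad_ex grad_cont (ric 1 ltr01)).
have sub : dir_subdiff V xbar u `<=` [set grad_x ybar].
  move=> xi Vxi; apply/eqP; rewrite -subr_eq0 -normr_le0.
  apply/ler_addgt0Pl => e e0; rewrite addr0.
  have [d d0 gd] := grad_near U_nbhs grad_cont Gybar e0.
  (* The inclusion for the ball of radius [d / 2] yields a solution within [d] of [ybar], whose
     gradient is then [e]-close to the one at [ybar]. *)
  have d20 : 0 < d / 2 by rewrite divr_gt0.
  have [y [[[Gy _] _] /= yd] ->] :=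
    dir_subdiff_sub f_cont Gamma_closed U_nbhs grad_ex grad_cont (ric _ d20) Vxi.
  by apply/ltW/gd => //; [rewrite subrr normr0|lra].
(* One subgradient suffices: a nonempty subset of a singleton is all of it. *)
have [y Sy _] := dir_sol_neq0 f_cont Gamma_closed U_nbhs grad_ex grad_cont (ric 1 ltr01).
have [xi Vxi _] :=
  dir_subdiff_below f_cont Gamma_closed U_nbhs grad_ex grad_cont (ric 1 ltr01) 0 Sy.
by apply/seteqP; split => // _ ->; rewrite -(sub _ Vxi).
Qed.
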